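(* Let $\delta>0$ be small, $C_-$ the path from $-\delta-\pi i$ up to $-\delta+\pi i$, $C_+$ the path from $\delta-\pi i$ up to $\delta+\pi i$. Let $f$ be a $2\pi$-periodic holomorphic function of $n$ variables with $f(x_1,\dots,x_n)=f(\pm x_1,\dots,\pm x_n)$. For $X\in USp(2N)$ with eigenvalues $e^{\pm i\theta_1},\dots,e^{\pm i\theta_N}$, $0\le\theta_j\le\pi$, $$2^n\int_{USp(2N)}\sum_{j_1,\dots,j_n=1}^Nf(\theta_{j_1},\dots,\theta_{j_n})\,dX=\frac1{(2\pi i)^n}\sum_{K\cup L\cup M=\{1,\dots,n\}}(2N)^{|M|}\int_{C_+^K}\int_{C_-^{L\cup M}}J_{USp(2N)}(z_K\cup -z_L)f(iz_1,\dots,iz_n)\,dz_1\cdots dz_n,$$ the sum over ordered triples of pairwise disjoint sets with union $\{1,\dots,n\}$, the variables $z_k$ ($k\in K$) integrated along $C_+$ and the others along $C_-$, where $$J_{USp(2N)}(A)=\int_{USp(2N)}\prod_{\alpha\in A}(-e^{-\alpha})\frac{\Lambda_X'}{\Lambda_X}(e^{-\alpha})\,dX.$$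
   Context: $USp(2N)$ is the group of $2N\times 2N$ unitary symplectic matrices with normalized Haar measure $dX$; $\Lambda_X(w)=\det(I-wX^* )$; $z_K=\{z_k:k\in K\}$, $-z_L=\{-z_l:l\in L\}$. *)

(* Defs.v *)
(* Everything below is stated over an arbitrary model R of the real numbers
   (a realType); the complex numbers are R[i]. *)
From HB Require Import structures.
From mathcomp Require Import all_boot all_order all_algebra.
From mathcomp Require Import complex spectral.
From mathcomp Require Import all_classical all_reals all_analysis.

Set Implicit Arguments.
Unset Strict Implicit.
Unset Printing Implicit Defensive.

Import Order.TTheory GRing.Theory Num.Theory numFieldNormedType.Exports.

Local Open Scope classical_set_scope.
Local Open Scope ring_scope.
Local Open Scope complex_scope.
Local Open Scope sesquilinear_scope.

(* The topology and norm of R[i] as a module over itself.  In particular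
   derive1 and differentiable are complex derivatives. *)
HB.instance Definition _ (R : realType) :=
  PseudoPointedMetric.copy R[i] R[i]^o.
HB.instance Definition _ (R : realType) := NormedModule.copy R[i] R[i]^o.

Definition cexp (R : realType) (z : R[i]) : R[i] :=
  (expR (complex.Re z) * cos (complex.Im z))
    +i* (expR (complex.Re z) * sin (complex.Im z)).

Definition Cintegral d (T : measurableType d) (R : realType)
    (mu : {measure set T -> \bar R}) (D : set T) (h : T -> R[i]) : R[i] :=
  (\int[mu]_(x in D) complex.Re (h x)) +i* (\int[mu]_(x in D) complex.Im (h x)).

Definition borel_mx (R : realType) (m : nat) :=
  g_sigma_algebraType (@open 'M[R[i]]_m).

Definition symplectic_form (R : realType) (N : nat) : 'M[R[i]]_(N + N) :=
  block_mx 0 1%:M (- 1%:M) 0.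

Definition USp (R : realType) (N : nat) : set 'M[R[i]]_(N + N) :=
  [set X | X \is unitarymx /\
           X^T *m symplectic_form R N *m X = symplectic_form R N].
Arguments USp : clear implicits.

(* Haar measure on USp(2N), regarded as a Borel measure on the space of all
   matrices which is carried by USp(2N). *)
Definition is_haar_USp (R : realType) (N : nat)
    (mu : probability (borel_mx R (N + N)) R) : Prop :=
  mu (USp R N) = 1%E /\
  forall g : 'M[R[i]]_(N + N), USp R N g ->
  forall A : set 'M[R[i]]_(N + N),
    measurable (A : set (borel_mx R (N + N))) ->
    mu [set g *m X | X in A] = mu A.

Definition Lambda (R : realType) (m : nat) (X : 'M[R[i]]_m) (w : R[i]) : R[i] :=
  \det (1%:M - w *: X^t*).

(* A is a list, so that coinciding points of z_K and -z_L both contribute a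
   factor. *)
Definition J_USp (R : realType) (N : nat)
    (mu : probability (borel_mx R (N + N)) R) (A : seq R[i]) : R[i] :=
  Cintegral mu (USp R N) (fun X =>
    \prod_(a <- A) (- cexp (- a) *
      (derive1 (Lambda X) (cexp (- a)) / Lambda X (cexp (- a))))).

(* Integral of h along the segment from a - pi i up to a + pi i. *)
Definition vint (R : realType) (a : R) (h : R[i] -> R[i]) : R[i] :=
  Cintegral (@lebesgue_measure R) `[- pi, pi] (fun t => h (a +i* t) * 'i%C).

(* Iterated integral, in the order dz_1 ... dz_n, the k-th variable running
   along the vertical segment of abscissa a k. *)
Fixpoint viter (R : realType) (n : nat) :
    ('I_n -> R) -> ('rV[R[i]]_n -> R[i]) -> R[i] :=
  match n return ('I_n -> R) -> ('rV[R[i]]_n -> R[i]) -> R[i] with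
  | 0 => fun _ h => h 0
  | n'.+1 => fun a h =>
      vint (a ord0) (fun z =>
        viter (fun k : 'I_n' => a (lift ord0 k))
              (fun v : 'rV_n' => h (row_mx (const_mx z : 'rV_1) v)))
  end.

(* Main.v *)
(* For X in USp(2N) with eigenvalues l, put
   h(z) = (-e^{-z}) (Lambda'/Lambda)(e^{-z}) = sum_l l / (e^z - l); since the
   spectrum is closed under inversion, h(-z) = -2N - h(z) off the imaginary
   axis.  Hence in one variable the terms K, L, M add up to
   int_{C_+} h f(i.) - int_{C_-} h f(i.), a contour integral around the period
   strip (the horizontal sides cancel by periodicity), whose residues at
   z = i theta give 2 pi i * sum f over the 2N eigenangles, i.e.
   2 pi i * 2 * sum_j f(theta_j) by evenness.  Applying this one variable at a
   time gives the n-variable identity for each fixed X; integrating over X and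
   exchanging with the contour integrals (the integrand is bounded, as
   |h| <= 2N / delta on C_+ and -C_-) yields the theorem.

   A triple (K, L, M) is encoded by the function 'I_n -> 'I_3 sending K, L, M to
   0, 1, 2.  Holomorphy is used in Caratheodory's form
   g w - g z = (w - z) * q w with q continuous at z. *)
Require Import Defs.
From mathcomp Require Import all_boot all_order all_algebra.
From mathcomp Require Import complex spectral.
From mathcomp Require Import all_classical all_reals all_analysis.
From mathcomp Require Import measurable_realfun.
From mathcomp Require Import ring lra.

Set Implicit Arguments.
Unset Strict Implicit.
Unset Printing Implicit Defensive.

Import Order.TTheory GRing.Theory Num.Theory numFieldNormedType.Exports.

Local Open Scope classical_set_scope.
Local Open Scope ring_scope.
Local Open Scope complex_scope.

(** * Complex numbers, the exponential and holomorphy *)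

(** No general residue theorem is involved. In [cint_residue] the value of [phi] at the pole is
    subtracted: the difference cancels the pole, and what remains is a constant times the integral
    of [ker l], found by pushing the line to infinity, where [ker l] tends to 0 on the right and to
    -1 on the left. The subtraction also settles the eigenangle pi, whose poles sit at the ends of
    the segments, where no small contour fits inside the period strip: across the imaginary axis
    only continuity of the regularized function is used. The second obstacle is measurability:
    [theta] is an arbitrary choice of eigenangles, so a sum over them is not visibly measurable in
    X. The products of h are rewritten through [Lambda], a polynomial in the conjugate entries of X,
    and the sum over eigenangles inherits measurability from the pointwise identity, which makes it
    a finite sum of iterated integrals. The exchange with the Haar integral is made one variable at
    a time, for integrands measurable in X and continuous in the height t, over all matrices with
    the indicator of USp(2N) as a factor. *)

Section ComplexBasics.
Context {R : realType}.
Local Notation C := R[i].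
Local Notation normc := (@ComplexField.Normc.normc R).

Lemma normrCE (z : C) : `|z| = (normc z)%:C.
Proof. by case: z. Qed.

Lemma normc_ge0 (z : C) : 0 <= normc z.
Proof. by rewrite -lecR -normrCE normr_ge0. Qed.

Lemma normc_gt0 (z : C) : (0 < normc z) = (z != 0).
Proof. by rewrite -ltcR -normrCE normr_gt0. Qed.

Lemma normc_ge_absRe (z : C) : `|complex.Re z| <= normc z.
Proof. by rewrite -lecR -normrCE normc_ge_Re. Qed.

Lemma normc_ge_absIm (z : C) : `|complex.Im z| <= normc z.
Proof.
by case: z => x y /=; rewrite -sqrtr_sqr ler_wsqrtr// lerDr sqr_ge0.
Qed.

Lemma normc_le_absReIm (z : C) :
  normc z <= `|complex.Re z| + `|complex.Im z|.
Proof.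
case: z => x y /=; rewrite -[leRHS]ger0_norm ?addr_ge0// -sqrtr_sqr ler_wsqrtr//.
by rewrite sqrrD !real_normK ?num_real// addrAC lerDl mulrn_wge0// mulr_ge0.
Qed.

(** The norm of [R[i]] takes its values in [R[i]]; testing with real [e] keeps all later estimates
    in [R]. *)
Lemma cvgcP {T : Type} {F : set_system T} {FF : Filter F} (g : T -> C) (z : C) :
  g @ F --> z <-> forall e : R, 0 < e -> \forall x \near F, normc (z - g x) < e.
Proof.
split=> [/cvgrPdist_lt gz e e0|gz].
  have /gz : 0 < e%:C :> C by rewrite ltcR.
  by apply: filterS => x; rewrite normrCE ltcR.
apply/cvgrPdist_lt => e e0.
have eE : e = (complex.Re e)%:C by rewrite RRe_real// gtr0_real.
move: e0; rewrite eE ltcR => /gz.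
by apply: filterS => x; rewrite normrCE ltcR.
Qed.

Lemma nbhsCP (z : C) (P : C -> Prop) : (\forall w \near z, P w) <->
  exists2 d : R, 0 < d & forall w, normc (z - w) < d -> P w.
Proof.
split=> [/nbhs_normP[/= d d0 dP]|[d d0 dP]]; last first.
  apply/nbhs_normP; exists d%:C; rewrite /= ?ltcR// => w.
  by rewrite /ball_/= normrCE ltcR; exact: dP.
have dE : d = (complex.Re d)%:C by rewrite RRe_real// gtr0_real.
exists (complex.Re d); first by rewrite -ltcR -dE.
by move=> w zw; apply: dP; rewrite /ball_/= dE normrCE ltcR.
Qed.

Lemma cvgRe {T : Type} {F : set_system T} {FF : Filter F} (g : T -> C) (z : C) :
  g @ F --> z -> complex.Re (g x) @[x --> F] --> complex.Re z.
Proof.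
move=> /cvgcP gz; apply/cvgrPdist_lt => e e0; near=> x.
apply: le_lt_trans (_ : normc (z - g x) < e); last by near: x; exact: gz.
have -> : complex.Re z - complex.Re (g x) = complex.Re (z - g x).
  by case: (z) (g x) => [? ?] [].
exact: normc_ge_absRe.
Unshelve. all: by end_near. Qed.

Lemma cvgIm {T : Type} {F : set_system T} {FF : Filter F} (g : T -> C) (z : C) :
  g @ F --> z -> complex.Im (g x) @[x --> F] --> complex.Im z.
Proof.
move=> /cvgcP gz; apply/cvgrPdist_lt => e e0; near=> x.
apply: le_lt_trans (_ : normc (z - g x) < e); last by near: x; exact: gz.
have -> : complex.Im z - complex.Im (g x) = complex.Im (z - g x).
  by case: (z) (g x) => [? ?] [].
exact: normc_ge_absIm.
Unshelve. all: by end_near. Qed.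

Lemma continuous_Re : continuous (@complex.Re R).
Proof. by move=> z; apply: (@cvgRe _ (nbhs z) _ id z) => A. Qed.

Lemma continuous_Im : continuous (@complex.Im R).
Proof. by move=> z; apply: (@cvgIm _ (nbhs z) _ id z) => A. Qed.

Lemma cvg_complex {T : Type} {F : set_system T} {FF : Filter F} (u v : T -> R)
    (a b : R) :
  u @ F --> a -> v @ F --> b -> (u x +i* v x : C) @[x --> F] --> (a +i* b : C).
Proof.
move=> /cvgrPdist_lt ua /cvgrPdist_lt vb; apply/cvgcP => e e0; near=> x.
apply: le_lt_trans (normc_le_absReIm _) _ => /=; rewrite [ltRHS]splitr ltrD//.
- by near: x; apply: ua; rewrite divr_gt0.
- by near: x; apply: vb; rewrite divr_gt0.
Unshelve. all: by end_near. Qed.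

Lemma continuous_complex {T : topologicalType} (u v : T -> R) (x : T) :
  {for x, continuous u} -> {for x, continuous v} ->
  {for x, continuous (fun x => u x +i* v x : C)}.
Proof. exact: cvg_complex. Qed.

Lemma cexpD (z w : C) : cexp (z + w) = cexp z * cexp w.
Proof.
case: z w => [a b] [c d]; rewrite /cexp /= expRD cosD sinD.
by apply/eqP; rewrite eq_complex /=; apply/andP; split; apply/eqP; ring.
Qed.

Lemma cexp0 : cexp 0 = 1 :> C.
Proof. by rewrite /cexp/= expR0 cos0 sin0 mulr0 mulr1. Qed.

Lemma normc_cexp (z : C) : normc (cexp z) = expR (complex.Re z).
Proof.
case: z => a b /=; rewrite !exprMn -mulrDr cos2Dsin2 mulr1 sqrtr_sqr.
by rewrite ger0_norm// expR_ge0.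
Qed.

Lemma cexp_neq0 (z : C) : cexp z != 0.
Proof.
apply/eqP => z0; have := normc_cexp z; rewrite z0 ComplexField.Normc.normc0.
by move=> /esym/eqP; rewrite gt_eqF// expR_gt0.
Qed.

Lemma cexpN (z : C) : cexp (- z) = (cexp z)^-1.
Proof.
by apply: (mulfI (cexp_neq0 z)); rewrite -cexpD subrr cexp0 mulfV// cexp_neq0.
Qed.

Lemma cexp_2pi : cexp (0 +i* (2 * pi)) = 1 :> C.
Proof. by rewrite /cexp/= expR0 mulr_natl cos2pi sin2pi mulr0 mulr1. Qed.

Lemma near_neq0 {T : topologicalType} (f : T -> C) (x : T) :
  {for x, continuous f} -> f x != 0 -> \forall w \near x, f w != 0.
Proof.
move=> cf fx0; have f0 : 0 < normc (f x) by rewrite normc_gt0.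
have fw := (cvgcP (F := nbhs x) _ _).1 cf _ f0.
near=> w; have : normc (f x - f w) < normc (f x) by near: w; exact: fw.
by apply: contraTneq => ->; rewrite subr0 ltxx.
Unshelve. all: by end_near. Qed.

Lemma near_continuous {T : topologicalType} (f g : T -> C) (x : T) :
  (\forall w \near x, f w = g w) -> {for x, continuous f} -> {for x, continuous g}.
Proof.
move=> fg cf; rewrite /prop_for /continuous_at -(nbhs_singleton fg).
exact: cvg_trans (near_eq_cvg fg) cf.
Qed.

Definition holo (F : C -> C) (z : C) :=
  exists2 q : C -> C, {for z, continuous q} &
    \forall w \near z, F w = F z + (w - z) * q w.

Lemma holo_continuous F z : holo F z -> {for z, continuous F}.
Proof.
move=> [q cq Fq].
have : (F z + (w - z) * q w) @[w --> z] --> F z + (z - z) * q z.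
  have idz : (fun w : C => w) w @[w --> z] --> z by exact: cvg_id.
  exact: (cvgD (cvg_cst (F z)) (cvgM (cvgB idz (cvg_cst z)) cq)).
rewrite /continuous_at /= subrr !mul0r !addr0; apply: cvg_trans.
have E : {near z, (fun w => F z + (w - z) * q w) =1 F}.
  by near=> w; rewrite [RHS](near Fq w).
exact: near_eq_cvg E.
Unshelve. all: by end_near.
Qed.

Lemma holo_cst c z : holo (fun=> c) z.
Proof.
exists (fun=> 0); first exact: cst_continuous.
by near=> w; rewrite mulr0 addr0.
Unshelve. all: by end_near. Qed.

Lemma holo_id z : holo id z.
Proof.
exists (fun=> 1); first exact: cst_continuous.
by near=> w; rewrite mulr1 addrC subrK.
Unshelve. all: by end_near. Qed.

Lemma holoD F G z : holo F z -> holo G z -> holo (fun w => F w + G w) z.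
Proof.
move=> [p cp Fp] [q cq Gq]; exists (fun w => p w + q w).
  exact: (continuousD cp cq).
by near=> w; rewrite (near Fp w)// (near Gq w)//; ring.
Unshelve. all: by end_near.
Qed.

Lemma holoM F G z : holo F z -> holo G z -> holo (fun w => F w * G w) z.
Proof.
move=> hF [q cq Gq]; have cF := holo_continuous hF.
case: hF => p cp Fp; exists (fun w => p w * G z + F w * q w).
  by apply: (continuousD (continuousM cp _) (continuousM cF cq)); exact: cst_continuous.
by near=> w; rewrite (near Gq w)// (near Fp w)//; ring.
Unshelve. all: by end_near.
Qed.

Lemma holoV F z : F z != 0 -> holo F z -> holo (fun w => (F w)^-1) z.
Proof.
move=> Fz hF; have cF := holo_continuous hF.
have Fn0 := near_neq0 cF Fz.
case: hF => p cp Fp; exists (fun w => - p w / (F w * F z)).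
  apply: continuousM; first exact: (continuousN cp).
  apply: continuousV; first by rewrite mulf_neq0.
  by apply: (continuousM cF); exact: cst_continuous.
near=> w; have Fw := near Fp w; have Fw0 : F w != 0 by near: w.
have -> : (w - z) * (- p w / (F w * F z)) = (F z - F w) / (F w * F z).
  by rewrite {2}Fw//; ring.
by field; apply/andP.
Unshelve. all: by end_near.
Qed.

Lemma holo_comp F G z : holo F z -> holo G (F z) -> holo (G \o F) z.
Proof.
move=> hF [q cq Gq]; have cF := holo_continuous hF.
case: hF => p cp Fp; exists (fun w => p w * q (F w)).
  exact: (continuousM cp (continuous_comp cF cq)).
have GF : \forall w \near z, G (F w) = G (F z) + (F w - F z) * q (F w).
  by have := cF _ Gq.
by near=> w; rewrite /= (near GF w)// {1}(near Fp w)//; ring.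
Unshelve. all: by end_near.
Qed.

(** The difference quotient, completed by the derivative at 0. It is the real source of the slope of
    [cexp]. *)
Lemma caratheodory (f : R -> R) (x l : R) : is_derive x 1 f l ->
  exists2 q : R -> R, q h @[h --> (0:R)] --> q 0 &
    q 0 = l /\ forall h, f (h + x) = f x + h * q h.
Proof.
move=> [df fl].
exists (fun h => if h == 0 then l else h^-1 * (f (h + x) - f x)); last first.
  split=> [|h]; first by rewrite eqxx.
  case: eqP => [->|/eqP h0]; first by rewrite mul0r addr0 add0r.
  by rewrite mulrA divff// mul1r [RHS]addrC subrK.
rewrite eqxx; apply/cvgrPdist_lt => e e0.
have := df; rewrite /derivable -[X in cvg X]/(_ @ _) => /cvg_ex [l' l'P].
have ll : l' = l by rewrite -fl; apply/esym/cvg_lim.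
move: l'P; rewrite ll => /cvgrPdist_lt /(_ _ e0).
rewrite /dnbhs near_withinE /= => P; near=> h.
have [h0|h0] := eqVneq h 0; first by rewrite subrr normr0.
by have := near P h; rewrite /= [h *: 1]mulr1; apply.
Unshelve. all: by end_near.
Qed.

(** The complex derivative at 0 is assembled from the real slopes [a], [b], [c] of exp, cos and sin
    at 0. *)
Lemma cexp_slope : exists q : C -> C,
  [/\ {for 0, continuous q}, q 0 = 1 & forall w, cexp w = 1 + w * q w].
Proof.
have [a ca [a0 expE]] := caratheodory (is_derive_expR (0 : R)).
have [b cb [b0 cosE]] := caratheodory (is_derive_cos (0 : R)).
have [c cc [c0 sinE]] := caratheodory (is_derive_sin (0 : R)).
rewrite expR0 in a0 expE; rewrite sin0 oppr0 in b0; rewrite cos0 in c0 cosE.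
rewrite sin0 in sinE.
pose q h : C := if h == 0 then 1 else (cexp h - 1) / h.
exists q; split; first last.
- move=> w; rewrite /q; case: eqP => [->|/eqP w0].
    by rewrite cexp0 mul0r addr0.
  by rewrite mulrCA divff// mulr1 [RHS]addrC subrK.
- by rewrite /q eqxx.
rewrite /prop_for /continuous_at {2}/q eqxx.
(* For h = x + iy one has [cexp h - 1 = x * a x + y * r h], where [a x] tends to 1 and [r h] to i.
   Hence the quotient by h differs from 1 by (x (1 - a x) + y (i - r h)) / h, and |x|, |y| are at
   most |h|. *)
pose r (h : C) : C := 
  (expR (complex.Re h) * b (complex.Im h)) +i*
  (expR (complex.Re h) * c (complex.Im h)).
have cr : r h @[h --> 0] --> (0 +i* 1 : C).
  rewrite /r; have -> : 0 +i* 1 = (expR 0 * 0) +i* (expR 0 * 1) :> C.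
    by rewrite expR0 !mul1r.
  have cE : expR (complex.Re h) @[h --> (0:C)] --> expR (0 : R).
    by apply: continuous_comp; [exact: continuous_Re|exact: continuous_expR].
  have cB : b (complex.Im h) @[h --> (0:C)] --> b 0.
    exact: (@continuous_comp C R R (@complex.Im R) b 0 (@continuous_Im 0) cb).
  have cC : c (complex.Im h) @[h --> (0:C)] --> c 0.
    exact: (@continuous_comp C R R (@complex.Im R) c 0 (@continuous_Im 0) cc).
  rewrite b0 in cB; rewrite c0 in cC.
  exact: (cvg_complex (cvgM cE cB) (cvgM cE cC)).
have car : a (complex.Re h) @[h --> (0:C)] --> (1 : R).
  by rewrite -a0; exact: (@continuous_comp C R R (@complex.Re R) a 0 (@continuous_Re 0) ca).
apply/(cvgcP (F := nbhs (0 : C))) => e e0; near=> h.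
have [->|h0] := eqVneq h 0.
  by rewrite /q eqxx subrr ComplexField.Normc.normc0.
rewrite /q (negbTE h0).
have -> : 1 - (cexp h - 1) / h =
    ((complex.Re h)%:C * (1 - a (complex.Re h))%:C + (complex.Im h)%:C * ((0 +i* 1) - r h)) / h.
  apply: (mulIf h0); rewrite mulrBl mul1r !divfK//.
  rewrite /r /cexp; case: (h) => x y /=.
  have := expE x; have := cosE y; have := sinE y; rewrite !addr0 => -> -> xE.
  rewrite {1 2}xE; apply/eqP; rewrite eq_complex /=; apply/andP.
  by split; apply/eqP; rewrite ?xE; ring.
rewrite ComplexField.Normc.normcM ComplexField.Normc.normcV ltr_pdivrMr; last by rewrite normc_gt0.
have nR (x : R) : normc x%:C = `|x| by rewrite /= expr0n addr0 sqrtr_sqr.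
apply: le_lt_trans (le_normcD _ _) _; rewrite !ComplexField.Normc.normcM !nR.
rewrite [e]splitr mulrDl.
have h0' : 0 < normc h by rewrite normc_gt0.
rewrite ltrD// mulrC.
- apply: le_lt_trans (ler_wpM2l _ (normc_ge_absRe h)) _ => //.
  rewrite ltr_pM2r//; near: h.
  by have /cvgrPdist_lt := car; apply; rewrite divr_gt0.
- apply: le_lt_trans (ler_wpM2l (normc_ge0 _) (normc_ge_absIm h)) _ => //.
  rewrite ltr_pM2r//; near: h.
  by have /cvgcP := cr; apply; rewrite divr_gt0.
Unshelve. all: by end_near. Qed.

Lemma holo_cexp z : holo (@cexp R) z.
Proof.
have [q [cq _ qE]] := cexp_slope.
have -> : @cexp R = (fun w => cexp z * cexp (w - z)).
  by apply/funext => w; rewrite -cexpD addrC subrK.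
apply: holoM; first exact: holo_cst.
apply: (@holo_comp (fun w => w - z)).
  by apply: holoD; [exact: holo_id|exact: holo_cst].
rewrite subrr; exists q => //; near=> w; rewrite cexp0 subr0; exact: qE.
Unshelve. all: by end_near. Qed.

Lemma continuous_at_eq (q : C -> C) (x y : C) :
  x = y -> {for x, continuous q} -> {for y, continuous q}.
Proof. by move=> ->. Qed.

(** The factor [cexp z] stays outside so that, at a pole [cexp z = l], the denominator [cexp w - l]
    reads [l * ((w - z) * q w)]. *)
Lemma cexp_slope_at (z : C) : exists q : C -> C,
  [/\ {for z, continuous q}, q z = 1 &
      forall w, cexp w = cexp z * (1 + (w - z) * q w)].
Proof.
have [q [cq q1 qE]] := cexp_slope.
have zz : z - z = 0 by rewrite subrr.
have cz : {for z, continuous (fun w : C => w - z)}.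
  by apply: holo_continuous; apply: holoD; [exact: holo_id|exact: holo_cst].
have cq' : {for z - z, continuous q} := continuous_at_eq (esym zz) cq.
exists (fun w => q (w - z)); split; last 2 first.
- by rewrite zz.
- by move=> w; rewrite -qE -cexpD addrC subrK.
exact: (@continuous_comp C C C (fun w => w - z) q z cz cq').
Qed.

(** The direction [w] is arbitrary because the coordinate axes are later rotated by ['i]. *)
Lemma differentiable_holo_line n (f : 'rV[C]_n -> C) (v w : 'rV[C]_n) (z : C) :
  differentiable f (z *: w + v) -> holo (fun s => f (s *: w + v)) z.
Proof.
move=> /(@diff_derivable _ _ _ _ _ w) /cvg_ex[l lP].
pose q (s : C) : C := if s == z then l else (f (s *: w + v) - f (z *: w + v)) / (s - z).
exists q; last first.
  near=> s; rewrite /q; case: eqP => [->|/eqP sz].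
    by rewrite subrr mul0r addr0.
  by rewrite mulrCA divff ?subr_eq0// mulr1 [RHS]addrC subrK.
rewrite /prop_for /continuous_at {2}/q eqxx; apply/(cvgrPdist_lt (F := nbhs (z : C))) => e e0.
move: lP => /cvgrPdist_lt /(_ _ e0).
rewrite /dnbhs near_withinE => /nbhsCP[d d0 dP]; apply/nbhsCP; exists d => // s zs.
rewrite /q; have [sz|sz] := eqVneq s z; first by rewrite subrr normr0.
have s0 : s - z != 0 by rewrite subr_eq0.
have := dP (s - z); rewrite sub0r opprB => /(_ zs s0).
by rewrite /= /shift /= addrA -scalerDl subrK mulrC.
Unshelve. all: by end_near. Qed.

End ComplexBasics.

(** * Integrals over segments *)

Section SegmentIntegrals.
Context {R : realType}.
Local Notation C := R[i].
Local Notation normc := (@ComplexField.Normc.normc R).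
Local Notation leb := (@lebesgue_measure R).

Definition cint (a b : R) (h : R -> C) : C := Cintegral leb `[a, b] h.

(** Two-sided continuity even at the ends, so that it follows from continuity in the plane by
    composition with a line. *)
Definition cont_on (a b : R) (h : R -> C) :=
  forall t, a <= t <= b -> {for t, continuous h}.

Lemma integrable_itv (a b : R) (g : R -> R) :
  (forall t, a <= t <= b -> {for t, continuous g}) ->
  leb.-integrable `[a, b] (EFin \o g).
Proof.
move=> cg; apply: continuous_compact_integrable; first exact: segment_compact.
by apply: continuous_in_subspaceT => t; rewrite inE /= in_itv /=; exact: cg.
Qed.

Lemma cont_on_Re a b h : cont_on a b h ->
  leb.-integrable `[a, b] (EFin \o (fun t => complex.Re (h t))).
Proof.
move=> ch; apply: integrable_itv => t /ch.
exact: (@cvgRe _ _ (nbhs t) _ h).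
Qed.

Lemma cont_on_Im a b h : cont_on a b h ->
  leb.-integrable `[a, b] (EFin \o (fun t => complex.Im (h t))).
Proof.
move=> ch; apply: integrable_itv => t /ch.
exact: (@cvgIm _ _ (nbhs t) _ h).
Qed.

Lemma fine_leb_itv (a b : R) : a <= b -> fine (leb `[a, b]%classic) = b - a.
Proof.
move=> ab; rewrite lebesgue_measure_itv /= lte_fin; case: ltP => //= ba.
by have -> : b = a by [apply/le_anti/andP]; rewrite subrr.
Qed.

Lemma eq_cint a b (f g : R -> C) :
  (forall t, a <= t <= b -> f t = g t) -> cint a b f = cint a b g.
Proof.
move=> fg; rewrite /cint /Cintegral; congr (_ +i* _);
  by apply: eq_Rintegral => t; rewrite inE /= in_itv /= => /fg ->.
Qed.

Lemma cintD a b (f g : R -> C) : cont_on a b f -> cont_on a b g ->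
  cint a b (fun t => f t + g t) = cint a b f + cint a b g.
Proof.
move=> cf cg; rewrite /cint /Cintegral.
have -> : (fun t => complex.Re (f t + g t)) =
          (fun t => complex.Re (f t) + complex.Re (g t)).
  by apply/funext => t; case: (f t) (g t) => ? ? [].
have -> : (fun t => complex.Im (f t + g t)) =
          (fun t => complex.Im (f t) + complex.Im (g t)).
  by apply/funext => t; case: (f t) (g t) => ? ? [].
by rewrite !RintegralD//; [exact: cont_on_Im|exact: cont_on_Im|exact: cont_on_Re|exact: cont_on_Re].
Qed.

Lemma cont_onD a b f g : cont_on a b f -> cont_on a b g ->
  cont_on a b (fun t => f t + g t).
Proof. by move=> cf cg t ab; apply: continuousD; [exact: cf|exact: cg]. Qed.

Lemma cont_onM a b f g : cont_on a b f -> cont_on a b g ->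
  cont_on a b (fun t => f t * g t).
Proof. by move=> cf cg t ab; apply: continuousM; [exact: cf|exact: cg]. Qed.

Lemma cont_on_cst a b c : cont_on a b (fun=> c).
Proof. by move=> t _; exact: cst_continuous. Qed.

Lemma cintZ a b c (f : R -> C) : cont_on a b f ->
  cint a b (fun t => c * f t) = c * cint a b f.
Proof.
move=> cf; rewrite /cint /Cintegral; case: c => u v.
have iR := cont_on_Re cf; have iI := cont_on_Im cf.
have -> : (fun t => complex.Re ((u +i* v) * f t)) =
          (fun t => u * complex.Re (f t) - v * complex.Im (f t)).
  by apply/funext => t; case: (f t).
have -> : (fun t => complex.Im ((u +i* v) * f t)) =
          (fun t => u * complex.Im (f t) + v * complex.Re (f t)).
  by apply/funext => t; case: (f t).
have Z r (g : R -> R) : leb.-integrable `[a, b] (EFin \o g) ->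
    leb.-integrable `[a, b] (EFin \o (fun t => r * g t)).
  by move=> ig; exact: (@integrableZl _ _ _ leb _ (measurable_itv _) r _ ig).
rewrite RintegralB// ?RintegralD//; try exact: Z.
by rewrite !RintegralZl.
Qed.

Lemma cintN a b (f : R -> C) : cont_on a b f ->
  cint a b (fun t => - f t) = - cint a b f.
Proof.
move=> cf; rewrite -mulN1r -cintZ//; apply: eq_cint => t _.
by rewrite mulN1r.
Qed.

Lemma cintB a b (f g : R -> C) : cont_on a b f -> cont_on a b g ->
  cint a b (fun t => f t - g t) = cint a b f - cint a b g.
Proof.
move=> cf cg; rewrite -(cintN cg).
have cNg : cont_on a b (fun t => - g t).
  by move=> t ab; apply: continuousN; exact: cg.
exact: (cintD cf cNg).
Qed.

Lemma cint_cst a b c : a <= b -> cint a b (fun=> c) = c * (b - a)%:C.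
Proof.
move=> ab; rewrite /cint /Cintegral !Rintegral_cst//.
rewrite fine_leb_itv//; case: c => u v; apply/eqP.
by rewrite eq_complex /=; apply/andP; split; apply/eqP; ring.
Qed.

(** The factor 2 comes from bounding real and imaginary parts separately; only the order of
    magnitude matters later. *)
Lemma cint_norm a b (M : R) (f : R -> C) : a <= b -> cont_on a b f ->
  (forall t, a <= t <= b -> normc (f t) <= M) ->
  normc (cint a b f) <= 2 * M * (b - a).
Proof.
move=> ab cf fM; apply: le_trans (normc_le_absReIm _) _ => /=.
have H (g : R -> R) : leb.-integrable `[a, b] (EFin \o g) ->
    (forall t, a <= t <= b -> `|g t| <= M) ->
    `|\int[leb]_(x in `[a, b]) g x| <= M * (b - a).
  move=> ig gM; apply: le_trans (le_normr_Rintegral _ ig) _ => //.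
  rewrite -(fine_leb_itv ab) -Rintegral_cst//; apply: le_Rintegral => //.
  - exact: (integrable_norm ig).
  - by apply: integrable_itv => t _; exact: cst_continuous.
rewrite -mulrA mulr_natl mulr2n lerD//; apply: H.
- exact: cont_on_Re.
- by move=> t /fM; apply: le_trans; exact: normc_ge_absRe.
- exact: cont_on_Im.
- by move=> t /fM; apply: le_trans; exact: normc_ge_absIm.
Qed.

Lemma cint_split a c b (f : R -> C) : a <= c -> c <= b -> cont_on a b f ->
  cint a b f = cint a c f + cint c b f.
Proof.
move=> ac cb cf.
have H (g : R -> R) : leb.-integrable `[a, b] (EFin \o g) ->
    \int[leb]_(x in `[a, b]) g x =
    \int[leb]_(x in `[a, c]) g x + \int[leb]_(x in `[c, b]) g x.
  move=> ig.
  have := Rintegral_itvB ig (_ : BLeft a <= BRight c)%O (_ : BRight c <= BRight b)%O.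
  rewrite !bnd_simp => /(_ ac cb) => E.
  rewrite -(@Rintegral_itv_obnd_cbnd _ c (BRight b)) -?E; first by rewrite addrC subrK.
  apply: integrableS ig => //.
  by apply: subset_itvr; rewrite bnd_simp.
rewrite /cint /Cintegral (H _ (cont_on_Re cf)) (H _ (cont_on_Im cf)).
by apply/eqP; rewrite eq_complex /= !eqxx.
Qed.

Lemma Rint_id a b : a <= b ->
  \int[leb]_(x in `[a, b]) x = (b ^+ 2 - a ^+ 2) / 2.
Proof.
rewrite le_eqVlt => /predU1P[->|ab].
  by rewrite subrr mul0r set_itv1 Rintegral_set1.
pose p : {poly R} := 2^-1 *: 'X^2.
have pE x : p.[x] = x ^+ 2 / 2 by rewrite /p hornerZ hornerXn mulrC.
rewrite /Rintegral (@continuous_FTC2 _ id (horner p))//=.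
- by rewrite !pE -mulrBl.
- by apply: continuous_subspaceT => x; exact: cvg_id.
- split=> [x _| |].
  + exact: derivable_horner.
  + by apply: cvg_at_right_filter; exact: continuous_horner.
  + by apply: cvg_at_left_filter; exact: continuous_horner.
- move=> x _; rewrite -derivE /p derivZ derivXn !hornerE /=.
  by field.
Qed.

(** Affine functions are the only ones integrated in closed form: they are the local models in
    Goursat's argument. *)
Lemma cint_affine a b (c d : C) : a <= b ->
  cint a b (fun t => c + d * t%:C) =
  c * (b - a)%:C + d * ((b ^+ 2 - a ^+ 2) / 2)%:C.
Proof.
move=> ab.
have ct : cont_on a b (fun t => t%:C).
  move=> t _; apply: (@continuous_complex _ _ id (fun=> 0)).
    exact: cvg_id.
  exact: cst_continuous.
rewrite (@cintD a b (fun=> c) (fun t => d * t%:C)); first last.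
- exact: (cont_onM (@cont_on_cst _ _ d) ct).
- exact: cont_on_cst.
rewrite cint_cst// (@cintZ a b d (fun t => t%:C))//; congr (_ + _ * _).
by rewrite /cint /Cintegral /= Rint_id// Rintegral_cst// mul0r.
Qed.

End SegmentIntegrals.

(** * Goursat's theorem on rectangles *)

Section Goursat.
Context {R : realType}.
Local Notation C := R[i].
Local Notation normc := (@ComplexField.Normc.normc R).

Lemma normcD (z w : C) : normc (z + w) <= normc z + normc w.
Proof. exact: le_normcD. Qed.

Lemma normc_sum4 (a b c d : C) :
  normc (a + b + c + d) <= normc a + normc b + normc c + normc d.
Proof. by do 3?[apply: le_trans (normcD _ _) _; rewrite lerD2r]. Qed.

Record box := Box { bx : R; by_ : R; bw : R; bh : R }.

Definition quarter (r : box) (b : bool * bool) :=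
  Box (bx r + if b.1 then bw r / 2 else 0) (by_ r + if b.2 then bh r / 2 else 0)
      (bw r / 2) (bh r / 2).

Definition subbox (r s : box) :=
  [/\ bx s <= bx r, bx r + bw r <= bx s + bw s,
      by_ s <= by_ r, by_ r + bh r <= by_ s + bh s & (0 <= bw r) && (0 <= bh r)].

Lemma subbox_quarter r s b : subbox r s -> subbox (quarter r b) s.
Proof.
move=> [h1 h2 h3 h4 /andP[h5 h6]]; case: b => -[] [];
  by split; rewrite /=; try lra; apply/andP; split; lra.
Qed.

(** Goursat's bisection for any [E] additive under quartering: some quarter keeps at least a fourth
    of the modulus, whereas the local bound at the limit point, quadratic in the size, carries an
    arbitrarily small factor. *)
Lemma box_bisection (E : box -> C) (r0 : box) :
  subbox r0 r0 ->
  (forall r, subbox r r0 -> E r =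
     E (quarter r (false, false)) + E (quarter r (true, false)) +
     E (quarter r (false, true)) + E (quarter r (true, true))) ->
  (forall p q, bx r0 <= p <= bx r0 + bw r0 -> by_ r0 <= q <= by_ r0 + bh r0 ->
   forall e, 0 < e -> exists2 eta, 0 < eta &
     forall r, subbox r r0 -> bw r < eta -> bh r < eta ->
       bx r <= p <= bx r + bw r -> by_ r <= q <= by_ r + bh r ->
       normc (E r) <= e * (bw r + bh r) ^+ 2) ->
  E r0 = 0.
Proof.
move=> r00 Esplit Eloc; apply/eqP; rewrite -[_ == _]negbK -normc_gt0; apply/negP => E0.
(* The existential stands outside the implication so that [choice] yields a total selector; boxes
   not inside [r0] get a dummy quarter. *)
have step (r : box) : exists b, subbox r r0 -> normc (E r) <= 4 * normc (E (quarter r b)).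
  have [rr0|] := pselect (subbox r r0); last by move=> nr; exists (true, true).
  have [b bP] : exists b, normc (E r) <= 4 * normc (E (quarter r b)); last by exists b.
  apply: contrapT => /forallNP H.
  have {}H b : 4 * normc (E (quarter r b)) < normc (E r).
    by rewrite ltNge; apply/negP; exact: H.
  have := normc_sum4 (E (quarter r (false, false))) (E (quarter r (true, false)))
    (E (quarter r (false, true))) (E (quarter r (true, true))).
  rewrite -Esplit//.
  have := H (false, false); have := H (true, false).
  have := H (false, true); have := H (true, true); lra.
have [nb nbP] := choice step.
pose r k := iter k (fun r => quarter r (nb r)) r0.
have rS k : r k.+1 = quarter (r k) (nb (r k)) by [].
have rsub k : subbox (r k) r0.
  by elim: k => [//|k ih]; rewrite rS; exact: subbox_quarter.
have rw k : bw (r k) * 2 ^+ k = bw r0.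
  elim: k => [|k ih]; first by rewrite expr0 mulr1.
  by rewrite rS /= exprS mulrA divfK.
have rh k : bh (r k) * 2 ^+ k = bh r0.
  elim: k => [|k ih]; first by rewrite expr0 mulr1.
  by rewrite rS /= exprS mulrA divfK.
have rE k : normc (E r0) <= 4 ^+ k * normc (E (r k)).
  elim: k => [|k ih]; first by rewrite expr0 mul1r.
  apply: le_trans ih _; rewrite exprSr -mulrA ler_wpM2l ?exprn_ge0//.
  by rewrite rS; exact: nbP.
have rmono (k m : nat) : subbox (r (k + m)%N) (r k).
  elim: m => [|m ih]; last by rewrite addnS rS; exact: subbox_quarter.
  by rewrite addn0; have [_ _ _ _ ?] := rsub k; split.
have rcross (k m : nat) : subbox (r (maxn k m)) (r k).
  by rewrite -(subnKC (leq_maxl k m)); exact: rmono.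
(* Lower left corners are bounded by every upper right corner, so their suprema give a point common
   to all boxes. *)
pose p := sup (range (bx \o r)); pose q := sup (range (by_ \o r)).
have xub k : ubound (range (bx \o r)) (bx (r k) + bw (r k)).
  move=> _ [m _ <-] /=; have [a1 a2 _ _ /andP[a3 _]] := rcross k m.
  have [b1 _ _ _ _] := rcross m k; move: a1 a2 a3 b1; rewrite maxnC; lra.
have yub k : ubound (range (by_ \o r)) (by_ (r k) + bh (r k)).
  move=> _ [m _ <-] /=; have [_ _ a1 a2 /andP[_ a3]] := rcross k m.
  have [_ _ b1 _ _] := rcross m k; move: a1 a2 a3 b1; rewrite maxnC; lra.
have pP k : bx (r k) <= p <= bx (r k) + bw (r k).
  apply/andP; split; last by apply: ge_sup; [by exists (bx (r 0%N)), 0%N|exact: xub].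
  by apply: ub_le_sup; [exists (bx (r k) + bw (r k)); exact: xub|exists k].
have qP k : by_ (r k) <= q <= by_ (r k) + bh (r k).
  apply/andP; split; last by apply: ge_sup; [by exists (by_ (r 0%N)), 0%N|exact: yub].
  by apply: ub_le_sup; [exists (by_ (r k) + bh (r k)); exact: yub|exists k].
(* The [+ 1] makes [D] positive and the final bound strictly smaller than [normc (E r0)]. *)
pose D := (bw r0 + bh r0) ^+ 2 + 1.
have D0 : 0 < D by rewrite ltr_wpDl// sqr_ge0.
have e0 : 0 < normc (E r0) / (2 * D) by rewrite divr_gt0// mulr_gt0.
have [eta eta0 etaP] := Eloc p q (pP 0%N) (qP 0%N) _ e0.
have [w0 h0] : 0 <= bw r0 /\ 0 <= bh r0 by have [_ _ _ _ /andP] := r00.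
(* After this many bisections both sides are shorter than [eta]. *)
pose k := Num.Def.archi_bound ((bw r0 + bh r0) / eta).
have small : (bw r0 + bh r0) / eta < 2 ^+ k.
  apply: lt_trans (archi_boundP _) _; first by rewrite divr_ge0 ?addr_ge0// ltW.
  by rewrite -natrX ltr_nat ltn_expl.
have k0 : (0 : R) < 2 ^+ k by rewrite exprn_gt0.
rewrite ltr_pdivrMr// in small.
have sw : bw (r k) < eta.
  rewrite -(ltr_pM2r k0) rw; apply: le_lt_trans (_ : bw r0 + bh r0 < _).
    by rewrite lerDl.
  by rewrite mulrC.
have sh : bh (r k) < eta.
  rewrite -(ltr_pM2r k0) rh; apply: le_lt_trans (_ : bw r0 + bh r0 < _).
    by rewrite lerDr.
  by rewrite mulrC.
have := etaP (r k) (rsub k) sw sh (pP k) (qP k).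
move=> H; have := rE k; rewrite leNgt => /negP; apply.
have k4 : (0 : R) < 4 ^+ k by rewrite exprn_gt0.
have : 4 ^+ k * normc (E (r k)) <= normc (E r0) / (2 * D) * (bw r0 + bh r0) ^+ 2.
  apply: le_trans (ler_wpM2l (ltW k4) H) _.
  have -> : (4 : R) ^+ k = 2 ^+ k * 2 ^+ k by rewrite -exprMn -natrM.
  rewrite -(rw k) -(rh k) le_eqVlt; apply/orP; left; apply/eqP.
  by move: (_ / _) (2 ^+ k) => c t; ring.
move/le_lt_trans; apply.
have -> : normc (E r0) / (2 * D) * (bw r0 + bh r0) ^+ 2 =
          normc (E r0) * ((bw r0 + bh r0) ^+ 2 / (2 * D)).
  by rewrite -mulrA [(2 * D)^-1 * _]mulrC.
rewrite gtr_pMr// ltr_pdivrMr ?mulr_gt0// mul1r /D.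
by have := sqr_ge0 (bw r0 + bh r0); lra.
Qed.

(** The counterclockwise contour integral along the boundary: bottom, top, right side, left side. *)
Definition box_int (F : C -> C) (r : box) : C :=
  cint (bx r) (bx r + bw r) (fun s => F (s +i* by_ r)) -
  cint (bx r) (bx r + bw r) (fun s => F (s +i* (by_ r + bh r))) +
  'i * cint (by_ r) (by_ r + bh r) (fun t => F ((bx r + bw r) +i* t)) -
  'i * cint (by_ r) (by_ r + bh r) (fun t => F (bx r +i* t)).

Definition inbox (r : box) (z : C) :=
  (bx r <= complex.Re z <= bx r + bw r) && (by_ r <= complex.Im z <= by_ r + bh r).

Lemma continuous_hline (y : R) : continuous (fun s : R => s +i* y : C).
Proof.
move=> s; apply: (@continuous_complex _ _ id (fun=> y)).
  exact: cvg_id.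
exact: cst_continuous.
Qed.

Lemma continuous_vline (x : R) : continuous (fun t : R => x +i* t : C).
Proof.
move=> s; apply: (@continuous_complex _ _ (fun=> x) id).
  exact: cst_continuous.
exact: cvg_id.
Qed.

Lemma cont_on_hline F a b y :
  (forall s, a <= s <= b -> {for (s +i* y : C), continuous F}) ->
  cont_on a b (fun s => F (s +i* y)).
Proof.
move=> cF s /cF; exact: (@continuous_comp _ _ _ (fun s => s +i* y : C) F s (@continuous_hline y s)).
Qed.

Lemma cont_on_vline F a b x :
  (forall t, a <= t <= b -> {for (x +i* t : C), continuous F}) ->
  cont_on a b (fun t => F (x +i* t)).
Proof.
move=> cF s /cF; exact: (@continuous_comp _ _ _ (fun s => x +i* s : C) F s (@continuous_vline x s)).
Qed.

(** Each inner edge belongs to two quarters and is traversed in opposite directions. *)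
Lemma box_int_quarter F r : 0 <= bw r -> 0 <= bh r ->
  (forall z, inbox r z -> {for z, continuous F}) ->
  box_int F r =
     box_int F (quarter r (false, false)) + box_int F (quarter r (true, false)) +
     box_int F (quarter r (false, true)) + box_int F (quarter r (true, true)).
Proof.
case: r => x y w h /= w0 h0 cF; rewrite /box_int /quarter /= !addr0.
have hw : w / 2 + w / 2 = w by rewrite -splitr.
have hh : h / 2 + h / 2 = h by rewrite -splitr.
have cH t : y <= t <= y + h -> cont_on x (x + w) (fun s => F (s +i* t)).
  by move=> yt; apply: cont_on_hline => s xs; apply: cF; rewrite /inbox /= xs yt.
have cV s : x <= s <= x + w -> cont_on y (y + h) (fun t => F (s +i* t)).
  by move=> xs; apply: cont_on_vline => t yt; apply: cF; rewrite /inbox /= xs yt.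
have sH t : y <= t <= y + h -> cint x (x + w) (fun s => F (s +i* t)) =
    cint x (x + w / 2) (fun s => F (s +i* t)) + cint (x + w / 2) (x + w) (fun s => F (s +i* t)).
  by move=> yt; apply: (cint_split _ _ (cH t yt)); lra.
have sV s : x <= s <= x + w -> cint y (y + h) (fun t => F (s +i* t)) =
    cint y (y + h / 2) (fun t => F (s +i* t)) + cint (y + h / 2) (y + h) (fun t => F (s +i* t)).
  by move=> xs; apply: (cint_split _ _ (cV s xs)); lra.
rewrite -!(addrA x) -!(addrA y) hw hh.
have y1 : y <= y <= y + h by lra.
have y2 : y <= y + h <= y + h by lra.
have x1 : x <= x <= x + w by lra.
have x2 : x <= x + w <= x + w by lra.
by rewrite (sH _ y1) (sH _ y2) (sV _ x1) (sV _ x2); ring.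
Qed.

Lemma box_int_affine (c d : C) r : 0 <= bw r -> 0 <= bh r ->
  box_int (fun z => c + d * z) r = 0.
Proof.
case: r => x y w h /= w0 h0; rewrite /box_int /=.
have H t : cint x (x + w) (fun s => c + d * (s +i* t)) =
   (c + d * (t%:C * 'i)) * (x + w - x)%:C + d * (((x + w) ^+ 2 - x ^+ 2) / 2)%:C.
  rewrite -cint_affine; last by lra.
  apply: eq_cint => s _; rewrite -addrA -mulrDr; congr (_ + _ * _).
  by apply/eqP; rewrite eq_complex /=; apply/andP; split; apply/eqP; ring.
have V s : cint y (y + h) (fun t => c + d * (s +i* t)) =
   (c + d * s%:C) * (y + h - y)%:C + (d * 'i) * (((y + h) ^+ 2 - y ^+ 2) / 2)%:C.
  rewrite -cint_affine; last by lra.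
  apply: eq_cint => t _; rewrite -addrA -mulrA -mulrDr; congr (_ + _ * _).
  by apply/eqP; rewrite eq_complex /=; apply/andP; split; apply/eqP; ring.
rewrite !H !V.
have i2 : 'i * 'i = -1 :> C by rewrite -expr2 sqr_i.
clear H V i2; case: c => c1 c2; case: d => d1 d2.
by apply/eqP; rewrite eq_complex /=; apply/andP; split; apply/eqP; field.
Qed.

(** The perimeter [2 * (bw r + bh r)], times the factor 2 of [cint_norm]. *)
Lemma box_int_le F r M : 0 <= bw r -> 0 <= bh r ->
  (forall z, inbox r z -> {for z, continuous F}) ->
  (forall z, inbox r z -> normc (F z) <= M) ->
  normc (box_int F r) <= 4 * M * (bw r + bh r).
Proof.
case: r => x y w h w0 h0 cF FM; rewrite /= in w0 h0.
rewrite /box_int [bx _]/= [by_ _]/= [bw _]/= [bh _]/=.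
have ni (z : C) : normc ('i * z) = normc z.
  by rewrite ComplexField.Normc.normcM /= expr0n expr1n add0r sqrtr1 mul1r.
have cH t : y <= t <= y + h -> normc (cint x (x + w) (fun s => F (s +i* t))) <= 2 * M * w.
  move=> yt; apply: le_trans (@cint_norm _ x (x + w) M _ _ _ _) _; first by lra.
  - by apply: cont_on_hline => s xs; apply: cF; rewrite /inbox /= xs yt.
  - by move=> s xs; apply: FM; rewrite /inbox /= xs yt.
  - by rewrite addrC addKr.
have cV s : x <= s <= x + w -> normc (cint y (y + h) (fun t => F (s +i* t))) <= 2 * M * h.
  move=> xs; apply: le_trans (@cint_norm _ y (y + h) M _ _ _ _) _; first by lra.
  - by apply: cont_on_vline => t yt; apply: cF; rewrite /inbox /= xs yt.
  - by move=> t yt; apply: FM; rewrite /inbox /= xs yt.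
  - by rewrite addrC addKr.
apply: le_trans (normc_sum4 _ _ _ _) _; rewrite !normcN !ni.
have h1 := cH y; have h2 := cH (y + h); have h3 := cV x; have h4 := cV (x + w).
have {}h1 : normc (cint x (x + w) (fun s => F (s +i* y))) <= 2 * M * w by apply: h1; lra.
have {}h2 : normc (cint x (x + w) (fun s => F (s +i* (y + h)))) <= 2 * M * w by apply: h2; lra.
have {}h3 : normc (cint y (y + h) (fun t => F (x +i* t))) <= 2 * M * h by apply: h3; lra.
have {}h4 : normc (cint y (y + h) (fun t => F ((x + w) +i* t))) <= 2 * M * h by apply: h4; lra.
by lra.
Qed.

Lemma box_intD F G r : 0 <= bw r -> 0 <= bh r ->
  (forall z, inbox r z -> {for z, continuous F}) ->
  (forall z, inbox r z -> {for z, continuous G}) ->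
  box_int (fun z => F z + G z) r = box_int F r + box_int G r.
Proof.
case: r => x y w h /= w0 h0 cF cG; rewrite /box_int /=.
have cH (H : C -> C) t : (forall z, inbox (Box x y w h) z -> {for z, continuous H}) ->
    y <= t <= y + h -> cont_on x (x + w) (fun s => H (s +i* t)).
  by move=> cK yt; apply: cont_on_hline => s xs; apply: cK; rewrite /inbox /= xs yt.
have cV (H : C -> C) s : (forall z, inbox (Box x y w h) z -> {for z, continuous H}) ->
    x <= s <= x + w -> cont_on y (y + h) (fun t => H (s +i* t)).
  by move=> cK xs; apply: cont_on_vline => t yt; apply: cK; rewrite /inbox /= xs yt.
have y1 : y <= y <= y + h by lra.
have y2 : y <= y + h <= y + h by lra.
have x1 : x <= x <= x + w by lra.
have x2 : x <= x + w <= x + w by lra.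
rewrite (cintD (cH _ _ cF y1) (cH _ _ cG y1)) (cintD (cH _ _ cF y2) (cH _ _ cG y2)).
rewrite (cintD (cV _ _ cF x1) (cV _ _ cG x1)) (cintD (cV _ _ cF x2) (cV _ _ cG x2)).
by ring.
Qed.

Lemma goursat F r : subbox r r -> (forall z, inbox r z -> holo F z) -> box_int F r = 0.
Proof.
move=> rr hF; apply: box_bisection => // [s sr|p q pP qP e e0].
  have [? ? ? ? /andP[? ?]] := sr.
  apply: box_int_quarter => // z zs; apply: holo_continuous; apply: hF.
  by move: zs => /andP[/andP[? ?] /andP[? ?]]; rewrite /inbox; lra.
have [g cg Fg] : holo F (p +i* q) by apply: hF; rewrite /inbox /= pP qP.
have /(cvgcP (F := nbhs (p +i* q : C))) cg' := cg.
(* The 4 compensates the constant in [box_int_le]. *)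
have e4 : 0 < e / 4 by rewrite divr_gt0.
have [d d0 dP] := (nbhsCP _ _).1 (filterI (cg' _ e4) Fg).
(* Sides below [d / 2] keep the whole box within distance [w + h < d] of the point [z0]. *)
exists (d / 2); first by rewrite divr_gt0.
case=> x y w h sr wd hd px qy; rewrite /= in wd hd px qy.
have [h1 h2 h3 h4 /andP[w0 h0]] := sr; rewrite /= in h1 h2 h3 h4 w0 h0.
set z0 : C := p +i* q in cg cg' dP *.
have cF z : inbox (Box x y w h) z -> {for z, continuous F}.
  move=> /andP[/andP[/= ? ?] /andP[? ?]].
  by apply: holo_continuous; apply: hF; rewrite /inbox; lra.
(* [G] is the tangent affine map at [z0], whose contour integral vanishes. The remainder
   [H z = (z - z0) * (g z - g z0)] is at most [(w + h) * (e / 4)]. *)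
pose G z := (F z0 - z0 * g z0) + g z0 * z.
pose H z := F z - G z.
have cG (z : C) : {for z, continuous G}.
  apply: continuousD; first exact: cst_continuous.
  by apply: continuousM; [exact: cst_continuous|exact: cvg_id].
have cH z : inbox (Box x y w h) z -> {for z, continuous H}.
  by move=> /cF cFz; exact: (continuousB cFz (cG z)).
have -> : F = (fun z => G z + H z) by apply/funext => z; rewrite /H addrC subrK.
rewrite (@box_intD G H (Box x y w h) w0 h0 (fun z _ => cG z) cH).
rewrite (_ : box_int G _ = 0) ?add0r; last exact: box_int_affine.
apply: le_trans (_ : 4 * ((w + h) * (e / 4)) * (w + h) <= _); last first.
  by rewrite /= expr2; lra.
apply: box_int_le => //= z zr.
have zd : normc (z0 - z) <= w + h.
  apply: le_trans (normc_le_absReIm _) _.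
  move: zr => /andP[/= hx hy]; rewrite /z0; case: z hx hy => zx zy /= hx hy.
  by rewrite lerD// ler_norml; lra.
have zdd : normc (z0 - z) < d by lra.
have [gz Fz] := dP z zdd.
have -> : H z = (z - z0) * (g z - g z0).
  by rewrite /H /G Fz; ring.
rewrite ComplexField.Normc.normcM ler_pM ?normc_ge0//.
  by rewrite -normcN opprB.
by rewrite -normcN opprB ltW.
Qed.

(* Horizontal sides cancel by periodicity, so a vertical period integral does not depend on the abscissa. *)
Lemma vertical_shift F a b : a <= b ->
  (forall z : C, a <= complex.Re z <= b -> holo F z) ->
  (forall z, F (z + 0 +i* (2 * pi)) = F z) ->
  cint (- pi) pi (fun t => F (a +i* t)) = cint (- pi) pi (fun t => F (b +i* t)).
Proof.
move=> ab hF perF.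
have pi0 := pi_ge0 R.
have /(_ F) := @goursat ^~ (Box a (- pi) (b - a) (pi + pi)).
rewrite /box_int /=.
have -> : a + (b - a) = b by rewrite addrC subrK.
have -> : - pi + (pi + pi) = pi :> R by rewrite addKr.
have -> : cint a b (fun s => F (s +i* pi)) = cint a b (fun s => F (s +i* - pi)).
  apply: eq_cint => s _; rewrite -[RHS]perF; congr (F _).
  by apply/eqP; rewrite eq_complex /=; apply/andP; split; apply/eqP; ring.
rewrite subrr add0r => H; apply/esym/eqP; rewrite -subr_eq0.
have i0 : 'i != 0 :> C by rewrite eq_complex /= oner_eq0 andbF.
rewrite -(inj_eq (mulfI i0)) mulr0 mulrBr H//.
  by split; rewrite /=; try lra; apply/andP; split; lra.
by move=> z /andP[/= zr _]; apply: hF; move: zr; lra.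
Qed.

End Goursat.

(** * The one-variable residue formula *)

Section Residue.
Context {R : realType}.
Local Notation C := R[i].
Local Notation normc := (@ComplexField.Normc.normc R).

(** Joint continuity along the slice at [x0] becomes uniform by compactness of the segment;
    continuity of the nearby slices makes them integrable. *)
Lemma cint_continuous {T : topologicalType} (H : T -> R -> C) (x0 : T) a b :
  a <= b ->
  (forall t, a <= t <= b ->
     {for (x0, t), continuous (fun p : T * R => H p.1 p.2)}) ->
  (\forall x \near x0, cont_on a b (H x)) ->
  {for x0, continuous (fun x => cint a b (H x))}.
Proof.
move=> ab cH ncH; apply/(cvgcP (F := nbhs x0)) => e e0.
have cH0 : cont_on a b (H x0) by exact: nbhs_singleton ncH.
(* The 2 is that of [cint_norm]; the [+ 1] covers [a = b] and makes the estimate strict. *)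
pose d := e / (2 * (b - a) + 1).
have D0 : 0 < 2 * (b - a) + 1 by rewrite ltr_wpDl// mulr_ge0// subr_ge0.
have d0 : 0 < d by rewrite divr_gt0.
have d20 : 0 < d / 2 by rewrite divr_gt0.
have /compact_near_coveringP ncov := @segment_compact R a b.
have unif : \forall x \near x0, `[a, b]%classic `<=` (fun t => normc (H x0 t - H x t) < d).
  apply: (ncov T (nbhs x0) (fun x t => normc (H x0 t - H x t) < d)) => t.
  rewrite /= in_itv /= => tab.
  have /(cvgcP (F := nbhs (x0, t))) /(_ _ d20) /= [[A B] /= [nA nB] AB] := cH t tab.
  exists (B, A); first by split.
  move=> [t' x] /= [Bt Ax].
  have A0 : A x0 by exact: nbhs_singleton nA.
  have h1 := AB (x, t') (conj Ax Bt); have h2 := AB (x0, t') (conj A0 Bt).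
  rewrite /= in h1 h2.
  have -> : H x0 t' - H x t' = (H x0 t - H x t') - (H x0 t - H x0 t') by ring.
  by apply: le_lt_trans (normcD _ _) _; rewrite normcN; lra.
near=> x.
have cHx : cont_on a b (H x) by near: x.
have ux : `[a, b]%classic `<=` (fun t => normc (H x0 t - H x t) < d) by near: x.
rewrite -(cintB cH0 cHx).
apply: le_lt_trans (@cint_norm _ a b d _ ab _ _) _.
- by move=> t tab; exact: (continuousB (cH0 t tab) (cHx t tab)).
- by move=> t tab; apply: ltW; apply: ux; rewrite /= in_itv.
- have : d * (2 * (b - a) + 1) = e by rewrite /d divfK// gt_eqF.
  by move: d0; clear; nra.
Unshelve. all: by end_near. Qed.

(** The constant [4 * pi] is what [cint_norm] gives on a segment of length 2 pi. *)
Lemma normc0_le_inv (z : C) (d : R) :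
  (forall b, d <= b -> 0 < b -> normc z <= 4 * pi / b) -> z = 0.
Proof.
move=> H; apply/eqP; rewrite -[_ == _]negbK -normc_gt0; apply/negP => z0.
have pi0 := pi_gt0 R.
(* From [8 * pi / normc z] on, the assumed bound is at most half of [normc z]. *)
pose b := Num.max d (8 * pi / normc z).
have b0 : 0 < b by rewrite lt_max divr_gt0 ?orbT// mulr_gt0.
have := H b; rewrite le_max lexx b0 => /(_ isT isT).
rewrite ler_pdivlMr// leNgt => /negP; apply.
have : 8 * pi / normc z <= b by rewrite le_max lexx orbT.
rewrite ler_pdivrMr// => ?; nra.
Qed.

(** The line is pushed to infinity: its integral does not depend on the abscissa, while the
    integrand decays. *)
Lemma cint_decay (g : R -> R -> C) (d : R) :
  (forall b, d <= b -> cont_on (- pi) pi (g b)) ->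
  (forall b, d <= b -> cint (- pi) pi (g d) = cint (- pi) pi (g b)) ->
  (forall b t, d <= b -> 0 < b -> normc (g b t) <= b^-1) ->
  cint (- pi) pi (g d) = 0.
Proof.
move=> cg gE gb; have pi0 := pi_ge0 R; apply: (@normc0_le_inv _ d) => b db b0.
rewrite (gE b db); apply: le_trans (@cint_norm _ (- pi) pi (b^-1) _ _ (cg b db) _) _.
- by lra.
- by move=> t _; exact: gb.
- by rewrite le_eqVlt; apply/orP; left; apply/eqP; ring.
Qed.

Definition ker (l z : C) : C := l / (cexp z - l).

Lemma cexp_neq_unit (l z : C) : normc l = 1 -> complex.Re z != 0 -> cexp z - l != 0.
Proof.
move=> l1 z0; rewrite subr_eq0; apply: contra z0 => /eqP zl.
have := normc_cexp z; rewrite zl l1 => /esym; rewrite -[RHS]expR0 => /expR_inj ->.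
exact: eqxx.
Qed.

Lemma holo_ker l z : cexp z - l != 0 -> holo (ker l) z.
Proof.
move=> zl; apply: holoM; first exact: holo_cst.
apply: (@holoV _ (fun z => cexp z - l)) => //.
by apply: holoD; [exact: holo_cexp|exact: holo_cst].
Qed.

Lemma cexp_periodic (z : C) : cexp (z + 0 +i* (2 * pi)) = cexp z.
Proof. by rewrite cexpD cexp_2pi mulr1. Qed.

(** Since |e^z| = e^a, the denominator has modulus at least e^a - 1, hence at least a. *)
Lemma normc_ker_le l (a t : R) : normc l = 1 -> 0 < a ->
  normc (ker l (a +i* t)) <= a^-1.
Proof.
move=> l1 a0; rewrite /ker ComplexField.Normc.normcM ComplexField.Normc.normcV l1 mul1r.
have ea : 1 + a <= expR a by exact: expR_ge1Dx.
have h : a <= normc (cexp (a +i* t) - l).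
  have := normcD (cexp (a +i* t) - l) l; rewrite subrK normc_cexp l1 /=; lra.
by rewrite lef_pV2// posrE; exact: lt_le_trans h.
Qed.

(** The reflection [ker l z + 1 = - ker l^-1 (- z)] reduces the left half-plane to the bound on the
    right. *)
Lemma ker1_le l (a t : R) : normc l = 1 -> 0 < a ->
  normc (ker l (- a +i* t) + 1) <= a^-1.
Proof.
move=> l1 a0; have l0 : l != 0 by rewrite -normc_gt0 l1.
have h0 : cexp (- a +i* t) - l != 0.
  by apply: cexp_neq_unit => //=; rewrite oppr_eq0 gt_eqF.
have ll : normc l^-1 = 1 by rewrite ComplexField.Normc.normcV l1 invr1.
have h1 : cexp (a +i* - t) - l^-1 != 0.
  by apply: cexp_neq_unit => //=; rewrite gt_eqF.
have -> : ker l (- a +i* t) + 1 = - ker l^-1 (a +i* - t).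
  rewrite /ker; have E : cexp (- a +i* t) = (cexp (a +i* - t))^-1.
      rewrite -cexpN; congr cexp; apply/eqP.
    by rewrite eq_complex /= opprK !eqxx.
  move: h0 h1; rewrite E; move: (cexp_neq0 (a +i* - t)).
  move: (cexp _) => w w0 h0 h1.
  pose u := 1 - l * w.
  have e0 : w^-1 - l = u / w by rewrite /u; field.
  have e1 : w - l^-1 = - u / l by rewrite /u; field.
  have u0 : u != 0 by move: h0; rewrite e0 mulf_eq0 negb_or => /andP[].
  rewrite e0 e1; have -> : l / (u / w) + 1 = (l * w + u) / u by field; rewrite ?l0 ?u0 ?w0.
  have -> : - (l^-1 / (- u / l)) = u^-1 by field; rewrite ?l0 ?u0.
  by rewrite /u [l * w + _]addrC subrK mul1r.
by rewrite normcN; exact: normc_ker_le.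
Qed.

Lemma cont_on_holo (F : C -> C) (a : R) : (forall t, holo F (a +i* t)) -> cont_on (- pi) pi (fun t => F (a +i* t)).
Proof.
by move=> hF; apply: cont_on_vline => t _; exact: holo_continuous.
Qed.

Lemma cint_ker_right l d : normc l = 1 -> 0 < d ->
  cint (- pi) pi (fun t => ker l (d +i* t)) = 0.
Proof.
move=> l1 d0; apply: (@cint_decay (fun b t => ker l (b +i* t))) => [b db|b db|b t _ b0].
- apply: cont_on_holo => t; apply: holo_ker; apply: cexp_neq_unit => //=.
  by rewrite gt_eqF// (lt_le_trans d0).
- apply: vertical_shift => // [z /andP[dz _]|z]; last by rewrite /ker cexp_periodic.
  by apply: holo_ker; apply: cexp_neq_unit => //; rewrite gt_eqF// (lt_le_trans d0).
- exact: normc_ker_le.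
Qed.

(** Here it is [ker l + 1] that decays, and the constant 1 integrates to 2 pi. The jump of 2 pi
    between the two sides is the residue 1 of [ker l]. *)
Lemma cint_ker_left l d : normc l = 1 -> 0 < d ->
  cint (- pi) pi (fun t => ker l (- d +i* t)) = - (2 * pi)%:C.
Proof.
move=> l1 d0; have pi0 := pi_ge0 R.
have ck b : d <= b -> cont_on (- pi) pi (fun t => ker l (- b +i* t)).
  move=> db; apply: cont_on_holo => t; apply: holo_ker; apply: cexp_neq_unit => //=.
  by rewrite oppr_eq0 gt_eqF// (lt_le_trans d0).
have : cint (- pi) pi (fun t => ker l (- d +i* t) + 1) = 0.
  apply: (@cint_decay (fun b t => ker l (- b +i* t) + 1)) => [b db|b db|b t _ b0].
  - exact: (cont_onD (ck b db) (@cont_on_cst _ _ _ 1)).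
  - apply/esym; apply: (@vertical_shift _ (fun z => ker l z + 1)); first by lra.
      move=> z /andP[_ dz]; apply: holoD; last exact: holo_cst.
      by apply: holo_ker; apply: cexp_neq_unit => //; rewrite lt_eqF//; lra.
    by move=> z; rewrite /ker cexp_periodic.
  - exact: ker1_le.
rewrite (cintD (ck d (lexx d)) (@cont_on_cst _ _ _ 1)) cint_cst; last by lra.
rewrite mul1r => /eqP; rewrite addr_eq0 => /eqP ->.
by congr (- _%:C); ring.
Qed.

(** By the double angle formula sin (s / 2) = 0, and the sine is positive strictly between 0 and
    pi. *)
Lemma cos_eq1 (s : R) : 0 <= s <= 2 * pi -> cos s = 1 -> s = 0 \/ s = 2 * pi.
Proof.
move=> /andP[s0 s2] c1.
have : cos (s / 2 *+ 2) = 1 by rewrite -mulr_natr divfK.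
rewrite cos_mulr2n => h.
have h2 : sin (s / 2) = 0.
  apply/eqP; rewrite -sqrf_eq0; apply/eqP; have := cos2Dsin2 (s / 2).
  by rewrite mulr2n in h; lra.
have [->|sn0] := eqVneq s 0; first by left.
have [->|sn1] := eqVneq s (2 * pi); first by right.
have : 0 < sin (s / 2).
  apply: sin_gt0_pi; apply/andP; split.
    by rewrite divr_gt0// lt_neqAle eq_sym sn0.
  have : s < 2 * pi by rewrite lt_neqAle sn1.
  by move: (pi) => p; lra.
by rewrite h2 ltxx.
Qed.

(** The last two cases arise only when [t] and [u] are the two opposite ends of the segment. *)
Lemma cexp_eq_mod2pi (t u : R) : - pi <= t <= pi -> - pi <= u <= pi ->
  cexp (0 +i* t) = cexp (0 +i* u) -> [\/ t = u, t = u + 2 * pi | u = t + 2 * pi].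
Proof.
move=> tpi upi; rewrite /cexp /= expR0 !mul1r => -[ct st].
have c1 : cos (t - u) = 1 by rewrite cosB ct st -!expr2 cos2Dsin2.
have [tu|ut] := leP u t.
  have r : 0 <= t - u <= 2 * pi by lra.
  have [h|h] := cos_eq1 r c1.
  - by apply: Or31; lra.
  - by apply: Or32; lra.
have c2 : cos (u - t) = 1 by rewrite -opprB cosN.
have r : 0 <= u - t <= 2 * pi by lra.
have [h|h] := cos_eq1 r c2.
- by apply: Or31; lra.
- by apply: Or33; lra.
Qed.

(** Write [phi = phi0 + (phi - phi0)]. The constant part contributes the jump of [ker l]. In the
    other part the pole is removable, so its integral is constant in the abscissa on each side of
    the axis and continuous across it: it cancels. *)
Lemma cint_residue (phi : C -> C) (th d : R) :
  0 < d -> - pi <= th <= pi -> (forall z, holo phi z) ->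
  (forall z, phi (z + 0 +i* (2 * pi)) = phi z) ->
  cint (- pi) pi (fun t => ker (cexp (0 +i* th)) (d +i* t) * phi (d +i* t)) -
  cint (- pi) pi (fun t => ker (cexp (0 +i* th)) (- d +i* t) * phi (- d +i* t)) =
  (2 * pi)%:C * phi (0 +i* th).
Proof.
move=> d0 thpi hphi perphi; set l := cexp _; set phi0 := phi (0 +i* th).
have pi0 := pi_ge0 R.
have l1 : normc l = 1 by rewrite normc_cexp expR0.
have l0 : l != 0 by exact: cexp_neq0.
have /choice[q qP] : forall z, exists q : C -> C, {for z, continuous q} /\
    \forall w \near z, phi w = phi z + (w - z) * q w.
  by move=> z; have [q ? ?] := hphi z; exists q.
pose g z := ker l z * (phi z - phi0).
(* At a pole z, [phi w - phi0 = (w - z) * q z w] and [cexp w - l = l * ((w - z) * s w)], so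
   [g w = q z w / s w]; as [s z = 1], the limit is [q z z]. *)
pose G z := if cexp z == l then q z z else g z.
have hg z : cexp z - l != 0 -> holo g z.
  move=> zl; apply: holoM; first exact: holo_ker.
  by apply: holoD; [exact: hphi|exact: holo_cst].
have cG1 z : cexp z != l -> {for z, continuous G}.
  rewrite -subr_eq0 => zl.
  have cl : {for z, continuous (fun w => cexp w - l)}.
    apply: holo_continuous; apply: holoD; [exact: holo_cexp|exact: holo_cst].
  refine (@near_continuous _ C g G z _ _); last by apply: holo_continuous; exact: hg.
  have nz := near_neq0 cl zl.
  near=> w; rewrite /G ifN// -subr_eq0; near: w; exact: nz.
have cG2 z : cexp z = l -> phi z = phi0 -> {for z, continuous G}.
  move=> zl zphi; have [s [cs s1 sE]] := cexp_slope_at z.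
  have [cq qE] := qP z.
  have sz0 : s z != 0 by rewrite s1 oner_eq0.
  have nz := near_neq0 cs sz0.
  refine (@near_continuous _ C (fun w => q z w / s w) G z _ _); last first.
    exact: (continuousM cq (continuousV sz0 cs)).
  near=> w.
  have sw : s w != 0 by near: w; exact: nz.
  have pw : phi w = phi z + (w - z) * q z w by near: w; exact: qE.
  have ew : cexp w - l = l * ((w - z) * s w).
    by rewrite sE zl mulrDr mulr1 addrC addKr.
  have [wz|wz] := eqVneq w z.
    by rewrite wz s1 divr1 /G zl eqxx.
  have wz0 : w - z != 0 by rewrite subr_eq0.
  rewrite /G ifN; last by rewrite -subr_eq0 ew !mulf_neq0.
  rewrite /g /ker ew pw zphi [phi0 + _]addrC addrK; move: sw wz0 l0; clear.
  by move: (w - z) (s w) => u v v0 u0 l0; field; rewrite ?l0 ?u0 ?v0.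
have cG t : - pi <= t <= pi -> {for (0 +i* t), continuous G}.
  move=> tpi; have [tl|] := eqVneq (cexp (0 +i* t)) l; last exact: cG1.
  apply: (cG2 _ tl); rewrite /phi0.
  (* If [th] is one end of the segment, the other end is a pole too; periodicity gives [phi] the
     same value there. *)
  have [->|->|->] := cexp_eq_mod2pi tpi thpi tl; [by []| |].
  - rewrite -[RHS]perphi; congr phi; apply/eqP.
    by rewrite eq_complex /= addr0 !eqxx.
  - rewrite -[LHS]perphi; congr phi; apply/eqP.
    by rewrite eq_complex /= addr0 !eqxx.
have nl (a t : R) : a != 0 -> cexp (a +i* t) - l != 0.
  by move=> a0; exact: cexp_neq_unit.
pose I (a : R) := cint (- pi) pi (fun t => G (a +i* t)).
have cI : {for 0, continuous I}.
  apply: (@cint_continuous R (fun a t => G (a +i* t)) 0); first by lra.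
    move=> t tpi.
    apply: (@continuous_comp _ _ _ (fun p : R * R => p.1 +i* p.2 : C) G).
      by apply: continuous_complex; [exact: cvg_fst|exact: cvg_snd].
    exact: cG.
  near=> a; apply: cont_on_vline => t tpi.
  have [->|a0] := eqVneq a 0; first exact: cG.
  by apply: cG1; rewrite -subr_eq0; exact: nl.
have Ig a : a != 0 -> I a = cint (- pi) pi (fun t => g (a +i* t)).
  by move=> a0; apply: eq_cint => t _; rewrite /G ifN// -subr_eq0; exact: nl.
have perg z : g (z + 0 +i* (2 * pi)) = g z.
  by rewrite /g perphi /ker cexp_periodic.
(* The sign [s] handles both sides at once: a function constant for 0 < a <= d and continuous at 0
   takes that constant value at 0. *)
have I0 s : `|s| = 1 -> (forall a, 0 < a <= d -> I (s * a) = I (s * d)) -> I 0 = I (s * d).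
  move=> s1 sI; apply/eqP; rewrite -subr_eq0 -[_ == _]negbK -normc_gt0; apply/negP => e0.
  have nI : \forall a \near (0 : R), normc (I 0 - I a) < normc (I 0 - I (s * d)).
    exact: ((cvgcP (F := nbhs (0 : R)) _ _).1 cI _ e0).
  have [r r0 rP] := (nbhs_ballP _ _).1 nI; rewrite /= in r0.
  have m0 : 0 < Num.min (r / 2) d by rewrite lt_min d0 divr_gt0.
  have bm : ball (0 : R) r (s * Num.min (r / 2) d).
    rewrite /ball /= sub0r normrN normrM s1 mul1r gtr0_norm// gt_min.
    by rewrite gtr_pMr// invf_lt1// ltr1n.
  have : normc (I 0 - I (s * Num.min (r / 2) d)) < normc (I 0 - I (s * d)) := rP _ bm.
  by rewrite sI ?m0 ?ge_min ?lexx ?orbT// ltxx.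
have Ir : I 0 = I d.
  rewrite -[d]mul1r; apply: I0; first by rewrite normr1.
  move=> a /andP[a0 ad].
  have a0' : a != 0 by rewrite gt_eqF.
  have d0' : d != 0 by rewrite gt_eqF.
  rewrite (mul1r a) (mul1r d) (Ig a a0') (Ig d d0').
  apply: vertical_shift => // z /andP[az _]; apply: hg.
  by apply: cexp_neq_unit => //; rewrite gt_eqF// (lt_le_trans a0).
have Il : I 0 = I (- d).
  rewrite -mulN1r; apply: I0; first by rewrite normrN normr1.
  move=> a /andP[a0 ad].
  have a0' : - a != 0 by rewrite oppr_eq0 gt_eqF.
  have d0' : - d != 0 by rewrite oppr_eq0 gt_eqF.
  rewrite (mulN1r a) (mulN1r d) (Ig _ a0') (Ig _ d0').
  have ab : - d <= - a by rewrite lerN2.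
  have hab (z : C) : - d <= complex.Re z <= - a -> holo g z.
    move=> /andP[_ az]; apply: hg; apply: cexp_neq_unit; first exact: l1.
    by rewrite lt_eqF; [|apply: le_lt_trans az _; rewrite oppr_lt0].
  exact: (esym (vertical_shift ab hab perg)).
have K a : a != 0 -> cint (- pi) pi (fun t => ker l (a +i* t) * phi (a +i* t)) =
    I a + phi0 * cint (- pi) pi (fun t => ker l (a +i* t)).
  move=> a0; rewrite (Ig a a0).
  have ck : cont_on (- pi) pi (fun t => ker l (a +i* t)).
    by apply: cont_on_holo => t; apply: holo_ker; exact: nl.
  have cg : cont_on (- pi) pi (fun t => g (a +i* t)).
    by apply: cont_on_holo => t; apply: hg; exact: nl.
  rewrite -(cintZ phi0 ck) -(cintD cg (cont_onM (@cont_on_cst _ _ _ phi0) ck)).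
  by apply: eq_cint => t _; rewrite /g; ring.
have dn0 : d != 0 by rewrite gt_eqF.
have ndn0 : - d != 0 by rewrite oppr_eq0.
rewrite (K d dn0) (K (- d) ndn0) (cint_ker_right l1 d0) (cint_ker_left l1 d0) -Ir -Il.
move: (I 0) => c; rewrite mulr0 addr0 mulrN opprD opprK addrA.
by rewrite subrr add0r mulrC.
Unshelve. all: by end_near. Qed.

End Residue.

(** * Iterated integrals *)

Section Iterated.
Context {R : realType}.
Local Notation C := R[i].

Lemma continuous_mx {T : topologicalType} {K : numFieldType} {V : pseudoMetricType K}
    m n (g : T -> 'M[V]_(m, n)) (x : T) :
  (forall i j, {for x, continuous (fun y => g y i j)}) -> {for x, continuous g}.
Proof.
move=> cg; apply/cvg_ballP => e e0.
have H i j : \forall y \near x, ball (g x i j) e (g y i j).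
  by have /cvg_ballP := cg i j; apply.
have : \forall y \near x, forall i j, ball (g x i j) e (g y i j).
  by apply: filter_forall => i; apply: filter_forall => j; exact: H.
by apply: filterS => y Hy; split.
Qed.

Definition line n (a : 'I_n -> R) (t : 'rV[R]_n) : 'rV[C]_n :=
  \row_k (a k +i* t 0 k).

Lemma row_mx_head (V : Type) n (x : V) (v : 'rV[V]_n) :
  (row_mx (const_mx x : 'rV_1) v : 'rV_(n.+1)) ord0 ord0 = x.
Proof.
have : row_mx (const_mx x : 'rV_1) v ord0 (lshift n ord0) = x.
  by rewrite row_mxEl mxE.
by move=> {2}<-; congr (row_mx _ _ _ _); exact: val_inj.
Qed.

Lemma row_mx_tail (V : Type) n (x : V) (v : 'rV[V]_n) (k : 'I_n) :
  (row_mx (const_mx x : 'rV_1) v : 'rV_(n.+1)) ord0 (lift ord0 k) = v ord0 k.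
Proof.
rewrite -(row_mxEr (const_mx x : 'rV_1) v ord0 k).
by congr (row_mx _ _ _ _); exact: val_inj.
Qed.

Lemma line_cons n (a : 'I_n.+1 -> R) (t0 : R) (t : 'rV[R]_n) :
  line a (row_mx (const_mx t0 : 'rV_1) t) =
  row_mx (const_mx (a ord0 +i* t0) : 'rV_1) (line (fun k => a (lift ord0 k)) t).
Proof.
apply/rowP => k; rewrite [LHS]mxE.
have [j ->|->] := unliftP ord0 k.
  by rewrite !row_mx_tail mxE.
by rewrite !row_mx_head.
Qed.

(** Continuity along the contours only, since the integrands have poles on the imaginary axes. *)
Definition line_cont n (a : 'I_n -> R) (h : 'rV[C]_n -> C) :=
  continuous (fun t => h (line a t)).

Lemma continuous_cons {T : topologicalType} {K : numFieldType} n (u : T -> K) (v : T -> 'rV[K]_n) :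
  continuous u -> continuous v ->
  continuous (fun x => row_mx (const_mx (u x) : 'rV_1) (v x)).
Proof.
move=> cu cv x; apply: (@continuous_mx T K K) => i j; rewrite ord1.
case: (fintype.splitP j) => k jk.
  have -> : j = lshift n k by exact: val_inj.
  have -> : (fun y => row_mx (const_mx (u y) : 'rV_1) (v y) 0 (lshift n k)) = u.
    by apply/funext => y; rewrite row_mxEl mxE.
  exact: cu.
have -> : j = rshift 1 k by exact: val_inj.
have -> : (fun y => row_mx (const_mx (u y) : 'rV_1) (v y) 0 (rshift 1 k)) =
    (fun M : 'rV[K]_n => M 0 k) \o v.
  by apply/funext => y; rewrite row_mxEr.
apply: continuous_comp; first exact: cv.
exact: coord_continuous.
Qed.

Lemma id_continuous {T : topologicalType} : continuous (fun x : T => x).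
Proof. by move=> x; exact: cvg_id. Qed.

Lemma pair_continuous {T U V : topologicalType} (f : T -> U) (g : T -> V) x :
  {for x, continuous f} -> {for x, continuous g} ->
  {for x, continuous (fun y => (f y, g y))}.
Proof. by move=> cf cg; exact: (cvg_pair cf cg). Qed.

Lemma viterS n (a : 'I_n.+1 -> R) (h : 'rV[C]_n.+1 -> C) :
  viter a h = cint (- pi) pi (fun t => viter (fun k => a (lift ord0 k))
    (fun v => h (row_mx (const_mx (a ord0 +i* t) : 'rV_1) v)) * 'i).
Proof. by []. Qed.

(** The parameter space [T] is quantified inside the induction: the outermost variable joins it,
    giving [T * R], before the hypothesis is used. *)
Lemma viter_continuous n : forall (T : topologicalType) (H : T -> 'rV[C]_n -> C) a,
  continuous (fun p : T * 'rV[R]_n => H p.1 (line a p.2)) ->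
  continuous (fun x => viter a (H x)).
Proof.
elim: n => [|n ih] T H a cH.
  move=> x; have -> : (fun x => viter a (H x)) = (fun x => H x (line a 0)).
    by apply/funext => y /=; congr H; apply/rowP => -[].
  apply: (@continuous_comp _ _ _ (fun x => (x, 0) : T * 'rV[R]_0) (fun p => H p.1 (line a p.2))).
    by apply: pair_continuous; [exact: id_continuous|exact: cst_continuous].
  exact: cH.
have cV : continuous (fun p : T * R => viter (fun k => a (lift ord0 k))
    (fun v => H p.1 (row_mx (const_mx (a ord0 +i* p.2) : 'rV_1) v))).
  apply: (ih (T * R)%type (fun p v => H p.1 (row_mx (const_mx (a ord0 +i* p.2) : 'rV_1) v))) => p.
  have -> : (fun p : T * R * 'rV[R]_n => H p.1.1 (row_mx (const_mx (a ord0 +i* p.1.2) : 'rV_1)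
       (line (fun k => a (lift ord0 k)) p.2))) =
    (fun p => H p.1 (line a p.2)) \o
    (fun p : T * R * 'rV[R]_n => (p.1.1, row_mx (const_mx p.1.2 : 'rV_1) p.2 : 'rV_(n.+1))).
    by apply/funext => q /=; rewrite line_cons.
  apply: continuous_comp; last exact: cH.
  apply: pair_continuous.
    by apply: (@continuous_comp _ _ _ fst fst); exact: cvg_fst.
  apply: (@continuous_cons _ R n (fun p : T * R * 'rV[R]_n => p.1.2) snd) => q.
    by apply: (@continuous_comp _ _ _ fst snd); [exact: cvg_fst|exact: cvg_snd].
  exact: cvg_snd.
have cVi : continuous (fun p : T * R => viter (fun k => a (lift ord0 k))
    (fun v => H p.1 (row_mx (const_mx (a ord0 +i* p.2) : 'rV_1) v)) * 'i).
  by move=> p; apply: continuousM; [exact: cV|exact: cst_continuous].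
move=> x; apply: (@cint_continuous R T (fun x t => viter (fun k => a (lift ord0 k))
    (fun v => H x (row_mx (const_mx (a ord0 +i* t) : 'rV_1) v)) * 'i) x).
- by have := pi_ge0 R; lra.
- by move=> t _; exact: cVi.
- near=> y; move=> t _.
  apply: (@continuous_comp _ _ _ (fun t => (y, t) : T * R) (fun p : T * R => viter (fun k => a (lift ord0 k))
    (fun v => H p.1 (row_mx (const_mx (a ord0 +i* p.2) : 'rV_1) v)) * 'i)).
    by apply: pair_continuous; [exact: cst_continuous|exact: id_continuous].
  exact: cVi.
Unshelve. all: by end_near. Qed.

Lemma line_cont_cons n (a : 'I_n.+1 -> R) (h : 'rV[C]_n.+1 -> C) :
  line_cont a h ->
  continuous (fun t => viter (fun k => a (lift ord0 k))
    (fun v => h (row_mx (const_mx (a ord0 +i* t) : 'rV_1) v))).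
Proof.
move=> ch; apply: (@viter_continuous n R (fun t v => h (row_mx (const_mx (a ord0 +i* t) : 'rV_1) v))) => p.
have -> : (fun p : R * 'rV[R]_n => h (row_mx (const_mx (a ord0 +i* p.1) : 'rV_1)
       (line (fun k => a (lift ord0 k)) p.2))) =
    (fun t => h (line a t)) \o (fun p : R * 'rV[R]_n => row_mx (const_mx p.1 : 'rV_1) p.2 : 'rV_(n.+1)).
  by apply/funext => q /=; rewrite line_cons.
apply: continuous_comp; last exact: ch.
by apply: (@continuous_cons _ R n fst snd) => q; [exact: cvg_fst|exact: cvg_snd].
Qed.

Lemma line_cont_tail n (a : 'I_n.+1 -> R) (h : 'rV[C]_n.+1 -> C) t0 :
  line_cont a h ->
  line_cont (fun k => a (lift ord0 k)) (fun v => h (row_mx (const_mx (a ord0 +i* t0) : 'rV_1) v)).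
Proof.
move=> ch t.
have -> : (fun t => h (row_mx (const_mx (a ord0 +i* t0) : 'rV_1)
       (line (fun k => a (lift ord0 k)) t))) =
    (fun t => h (line a t)) \o (fun t : 'rV[R]_n => row_mx (const_mx t0 : 'rV_1) t : 'rV_(n.+1)).
  by apply/funext => q /=; rewrite line_cons.
apply: continuous_comp; last exact: ch.
by apply: (@continuous_cons _ R n (fun=> t0) id) => q; [exact: cst_continuous|exact: id_continuous].
Qed.

Lemma eq_viter n (a : 'I_n -> R) (h1 h2 : 'rV[C]_n -> C) :
  (forall t, h1 (line a t) = h2 (line a t)) -> viter a h1 = viter a h2.
Proof.
elim: n a h1 h2 => [|n ih] a h1 h2 h12.
  rewrite /=; have -> : (0 : 'rV[C]_0) = line a 0 by apply/rowP => -[].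
  exact: h12.
rewrite !viterS; apply: eq_cint => t _; congr (_ * _); apply: ih => t'.
by rewrite -line_cons.
Qed.

Lemma viterZ n (a : 'I_n -> R) c (h : 'rV[C]_n -> C) : line_cont a h ->
  viter a (fun z => c * h z) = c * viter a h.
Proof.
elim: n a h => [//|n ih] a h ch.
rewrite !viterS -cintZ; last first.
  move=> t _; apply: continuousM; last exact: cst_continuous.
  exact: line_cont_cons.
apply: eq_cint => t _; rewrite ih ?mulrA//; exact: line_cont_tail.
Qed.

End Iterated.

(** * The identity for a fixed spectrum *)

Section FfunCons.
Variables (A : finType) (n : nat).

Definition fcons (a : A) (f : {ffun 'I_n -> A}) : {ffun 'I_n.+1 -> A} :=
  [ffun k => if unlift ord0 k is Some j then f j else a].

Lemma fcons0 a f : fcons a f ord0 = a.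
Proof. by rewrite ffunE unlift_none. Qed.

Lemma fconsS a f k : fcons a f (lift ord0 k) = f k.
Proof. by rewrite ffunE liftK. Qed.

(** Applied both to the codes of triples and to the tuples of angles, which keeps the two sides
    parallel in the induction on n. *)
Lemma big_ffun_cons (V : nmodType) (F : {ffun 'I_n.+1 -> A} -> V) :
  \sum_f F f = \sum_a \sum_f F (fcons a f).
Proof.
rewrite pair_big /=.
rewrite (reindex (fun p : A * {ffun 'I_n -> A} => fcons p.1 p.2)) //=.
exists (fun f => (f ord0, [ffun k => f (lift ord0 k)])) => [[a f] _|f _] /=.
  by rewrite fcons0; congr pair; apply/ffunP => k; rewrite ffunE fconsS.
apply/ffunP => k; have [j ->|->] := unliftP ord0 k; last by rewrite fcons0.
by rewrite fconsS ffunE.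
Qed.

End FfunCons.

(** * The contour identity for a fixed family of angles *)

Section Pointwise.
Context {R : realType}.
Local Notation C := R[i].
Local Notation normc := (@ComplexField.Normc.normc R).

Lemma cint_sum (I : Type) (r : seq I) a b (F : I -> R -> C) :
  (forall i, cont_on a b (F i)) ->
  cint a b (fun t => \sum_(i <- r) F i t) = \sum_(i <- r) cint a b (F i).
Proof.
move=> cF; suff [] : cont_on a b (fun t => \sum_(i <- r) F i t) /\
  cint a b (fun t => \sum_(i <- r) F i t) = \sum_(i <- r) cint a b (F i) by [].
elim: r => [|i r [ih1 ih2]].
  have E : (fun t => \sum_(i <- [::]) F i t) = (fun=> 0 : C).
    by apply/funext => t; rewrite big_nil.
  rewrite E big_nil; split; first exact: cont_on_cst.
  rewrite -[RHS](mul0r (cint a b (fun=> 0))) -(@cintZ _ a b 0 (fun=> 0)); last exact: cont_on_cst.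
  by apply: eq_cint => t _; rewrite mul0r.
have E : (fun t => \sum_(j <- i :: r) F j t) = (fun t => F i t + \sum_(j <- r) F j t).
  by apply/funext => t; rewrite big_cons.
rewrite E big_cons; split; first exact: (cont_onD (cF i) ih1).
by rewrite (cintD (cF i) ih1) ih2.
Qed.

Lemma continuous_at_sum {T : topologicalType} (I : Type) (r : seq I) (F : I -> T -> C) x :
  (forall i, {for x, continuous (F i)}) ->
  {for x, continuous (fun y => \sum_(i <- r) F i y)}.
Proof.
move=> cF; elim: r => [|i r ih].
  rewrite (_ : (fun y => _) = (fun=> 0)); first exact: cst_continuous.
  by apply/funext => y; rewrite big_nil.
rewrite (_ : (fun y => _) = (fun y => F i y + \sum_(j <- r) F j y)).
  exact: (continuousD (cF i) ih).
by apply/funext => y; rewrite big_cons.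
Qed.

Lemma continuous_at_prod {T : topologicalType} (I : Type) (r : seq I) (F : I -> T -> C) x :
  (forall i, {for x, continuous (F i)}) ->
  {for x, continuous (fun y => \prod_(i <- r) F i y)}.
Proof.
move=> cF; elim: r => [|i r ih].
  rewrite (_ : (fun y => _) = (fun=> 1)); first exact: cst_continuous.
  by apply/funext => y; rewrite big_nil.
rewrite (_ : (fun y => _) = (fun y => F i y * \prod_(j <- r) F j y)).
  exact: (continuousM (cF i) ih).
by apply/funext => y; rewrite big_cons.
Qed.

Lemma continuous_line n (a : 'I_n -> R) : continuous (fun t => line a t : 'rV[C]_n).
Proof.
move=> t; apply: (@continuous_mx _ C C) => i j.
have -> : (fun y : 'rV[R]_n => line a y i j) = (fun y => a j +i* y 0 j : C).
  by apply/funext => y; rewrite mxE.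
apply: (@continuous_complex _ _ (fun=> a j) (fun y : 'rV[R]_n => y 0 j)).
  exact: cst_continuous.
exact: coord_continuous.
Qed.

(** [S] indexes the eigenvalues and the involution [sg] below pairs each with its inverse; matrices
    do not enter here. *)
Variables (S : finType) (th : S -> R) (delta : R).
Hypothesis delta0 : 0 < delta.
Hypothesis th_pi : forall s, - pi <= th s <= pi.
Variable sg : S -> S.
Hypothesis sgK : involutive sg.
Hypothesis th_sg : forall s, th (sg s) = - th s.

Let lam s : C := cexp (0 +i* th s).

Definition hsum (z : C) : C := \sum_s ker (lam s) z.

Definition kfac (c : 'I_3) (z : C) : C :=
  match val c with 0 => hsum z | 1 => hsum (- z) | _ => #|S|%:R end.

Definition kabs (c : 'I_3) : R := if val c == 0%N then delta else - delta.

Lemma lam1 s : normc (lam s) = 1.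
Proof. by rewrite normc_cexp expR0. Qed.

(** After reindexing by [sg] the identity is termwise: [ker l^-1 (- z) = -1 - ker l z]. *)
Lemma hsumN z : complex.Re z != 0 -> hsum (- z) = - #|S|%:R - hsum z.
Proof.
move=> z0; rewrite /hsum (reindex_inj (inv_inj sgK)) /=.
have -> : #|S|%:R = \sum_(s : S) (1 : C) by rewrite sumr_const.
rewrite -opprD -big_split /= -sumrN; apply: eq_bigr => s _.
have -> : lam (sg s) = (lam s)^-1.
  rewrite /lam th_sg -cexpN; congr cexp; apply/eqP.
  by rewrite eq_complex /= oppr0 !eqxx.
have l0 : lam s != 0 by exact: cexp_neq0.
rewrite /ker cexpN; have w0 := cexp_neq0 z.
have h0 : cexp z - lam s != 0 by apply: cexp_neq_unit => //; exact: lam1.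
move: (lam s) (cexp z) l0 w0 h0 => l w l0 w0 h0.
have -> : w^-1 - l^-1 = - (w - l) / (w * l) by field; rewrite ?l0 ?w0.
by field; rewrite ?l0 ?w0 ?h0.
Qed.

Lemma kabs_neq0 c : kabs c != 0.
Proof. by rewrite /kabs; case: ifP => _; rewrite ?oppr_eq0 gt_eqF. Qed.

Lemma hsum_continuous z : complex.Re z != 0 -> {for z, continuous hsum}.
Proof.
move=> z0; apply: continuous_at_sum => s; apply: holo_continuous.
by apply: holo_ker; apply: cexp_neq_unit => //; exact: lam1.
Qed.

Lemma kfac_continuous c z : complex.Re z != 0 -> {for z, continuous (kfac c)}.
Proof.
move=> z0; rewrite /kfac; case: c => -[|[|m]] /= _.
- exact: hsum_continuous.
- have z0' : complex.Re (- z) != 0 by move: z0; case: (z) => x y /=; rewrite oppr_eq0.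
  have cN : {for z, continuous (fun w : C => - w)}.
    by apply: (@continuousN _ C C id); exact: id_continuous.
  exact: (@continuous_comp C C C (fun w => - w) hsum z cN (hsum_continuous z0')).
- exact: cst_continuous.
Qed.

Lemma cont_kfac c (f : C -> C) : continuous f ->
  cont_on (- pi) pi (fun t => kfac c (kabs c +i* t) * f (kabs c +i* t) * 'i).
Proof.
move=> cf; apply: cont_onM; last exact: cont_on_cst.
apply: cont_onM; apply: cont_on_vline => t _; last exact: cf.
by apply: kfac_continuous; exact: kabs_neq0.
Qed.

Lemma one_variable (phi : C -> C) : (forall z, holo phi z) ->
  (forall z, phi (z + 0 +i* (2 * pi)) = phi z) ->
  \sum_c cint (- pi) pi (fun t => kfac c (kabs c +i* t) * phi (kabs c +i* t) * 'i) =
  (2 * pi%:C * 'i) * \sum_s phi (0 +i* th s).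
Proof.
move=> hphi perphi; rewrite !big_ord_recl big_ord0 addr0.
have cphi : continuous phi by move=> z; exact: holo_continuous.
rewrite -(cintD (@cont_kfac (lift ord0 ord0) _ cphi) (@cont_kfac (lift ord0 (lift ord0 ord0)) _ cphi)).
pose P a := fun s t => ker (lam s) (a +i* t) * phi (a +i* t).
have cP a s : a != 0 -> cont_on (- pi) pi (P a s).
  move=> a0; apply: cont_onM; apply: cont_on_vline => t _; last exact: cphi.
  by apply: holo_continuous; apply: holo_ker; apply: cexp_neq_unit => //; exact: lam1.
have E a : a != 0 -> cint (- pi) pi (fun t => hsum (a +i* t) * phi (a +i* t) * 'i) =
    'i * \sum_s cint (- pi) pi (P a s).
  move=> a0; have cPa s := cP a s a0.
  rewrite -(cint_sum _ cPa) -cintZ; last by move=> t tpi; apply: continuous_at_sum => s; exact: cPa.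
  by apply: eq_cint => t _; rewrite mulrC -mulr_suml.
have d0 : delta != 0 by rewrite gt_eqF.
have nd0 : - delta != 0 by rewrite oppr_eq0.
have -> : cint (- pi) pi (fun t => kfac ord0 (kabs ord0 +i* t) * phi (kabs ord0 +i* t) * 'i) =
    'i * \sum_s cint (- pi) pi (P delta s) by rewrite -E.
(* The terms for L and M share the contour C_-, and there [hsum (- z) + #|S| = - hsum z]. *)
have -> : cint (- pi) pi (fun t =>
     kfac (lift ord0 ord0) (kabs (lift ord0 ord0) +i* t) * phi (kabs (lift ord0 ord0) +i* t) * 'i +
     kfac (lift ord0 (lift ord0 ord0)) (kabs (lift ord0 (lift ord0 ord0)) +i* t) *
       phi (kabs (lift ord0 (lift ord0 ord0)) +i* t) * 'i) =
    - ('i * \sum_s cint (- pi) pi (P (- delta) s)).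
  rewrite -E// -[RHS]mulN1r -cintZ; last first.
    have cP' := cP (- delta) _ nd0.
    apply: cont_onM; last exact: cont_on_cst.
    apply: cont_onM; apply: cont_on_vline => t _; last exact: cphi.
    by apply: hsum_continuous.
  apply: eq_cint => t _; rewrite /kfac /kabs /= hsumN//.
  by ring.
rewrite -mulrBr -sumrB.
have -> : 2 * pi%:C * 'i = 'i * (2 * pi)%:C :> C.
  by rewrite mulrC; congr (_ * _); rewrite rmorphM /= rmorph_nat.
rewrite -mulrA [in RHS]mulr_sumr; congr (_ * _); apply: eq_bigr => s _.
exact: cint_residue.
Qed.

(** The part of holomorphy in n variables that is inherited when the first variable is frozen. *)
Definition sep_entire n (phi : 'rV[C]_n -> C) :=
  continuous phi /\
  forall k v z, holo (fun s => phi (s *: delta_mx 0 k + v)) z.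

(** The period is imaginary because [phi z] will be [f ('i *: z)]. *)
Definition periodic n (phi : 'rV[C]_n -> C) :=
  forall z k, phi (z + (0 +i* (2 * pi)) *: delta_mx 0 k) = phi z.

Lemma delta_cons n (s x : C) (k : 'I_n) (v : 'rV[C]_n) :
  row_mx (const_mx x : 'rV_1) (s *: delta_mx 0 k + v) =
  s *: delta_mx 0 (lift ord0 k) + (row_mx (const_mx x : 'rV_1) v : 'rV_(n.+1)).
Proof.
apply/rowP => j; rewrite [RHS]mxE [X in _ = X + _]mxE [delta_mx _ _ _ _]mxE.
have [i ->|->] := unliftP ord0 j.
  by rewrite !row_mx_tail !mxE (inj_eq lift_inj).
by rewrite !row_mx_head (negbTE (neq_lift _ _)) andbF mulr0 add0r.
Qed.

Lemma delta_head n (s : C) (v : 'rV[C]_n) :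
  row_mx (const_mx s : 'rV_1) v =
  s *: delta_mx 0 ord0 + (row_mx (const_mx 0 : 'rV_1) v : 'rV_(n.+1)).
Proof.
apply/rowP => j; rewrite [RHS]mxE [X in _ = X + _]mxE [delta_mx _ _ _ _]mxE.
have [i ->|->] := unliftP ord0 j.
  by rewrite !row_mx_tail eq_sym (negbTE (neq_lift _ _)) andbF mulr0 add0r.
by rewrite !row_mx_head !eqxx mulr1 addr0.
Qed.

Lemma sep_entire_tail n (phi : 'rV[C]_n.+1 -> C) x : sep_entire phi ->
  sep_entire (fun v : 'rV[C]_n => phi (row_mx (const_mx x : 'rV_1) v)).
Proof.
move=> [cphi hphi]; split=> [v|k v z].
  apply: (@continuous_comp _ _ _ (fun v : 'rV[C]_n => row_mx (const_mx x : 'rV_1) v : 'rV_n.+1) phi).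
    by apply: (@continuous_cons _ C n (fun=> x) id) => q; [exact: cst_continuous|exact: id_continuous].
  exact: cphi.
have -> : (fun s => phi (row_mx (const_mx x : 'rV_1) (s *: delta_mx 0 k + v))) =
   (fun s => phi (s *: delta_mx 0 (lift ord0 k) + (row_mx (const_mx x : 'rV_1) v : 'rV_(n.+1)))).
  by apply/funext => s; rewrite delta_cons.
exact: hphi.
Qed.

Lemma periodic_tail n (phi : 'rV[C]_n.+1 -> C) x : periodic phi ->
  periodic (fun v : 'rV[C]_n => phi (row_mx (const_mx x : 'rV_1) v)).
Proof.
move=> pphi v k; rewrite addrC delta_cons addrC; exact: pphi.
Qed.

Lemma line_cont_integrand n (a : 'I_n -> R) (g : 'I_n -> C -> C) (phi : 'rV[C]_n -> C) :
  (forall k t, {for (a k +i* t : C), continuous (g k)}) -> continuous phi ->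
  line_cont a (fun z => \prod_k g k (z 0 k) * phi z).
Proof.
move=> cg cphi t; apply: continuousM; last first.
  by apply: (@continuous_comp _ _ _ (line a) phi); [exact: continuous_line|exact: cphi].
apply: continuous_at_prod => k.
have -> : (fun y : 'rV[R]_n => g k (line a y 0 k)) =
    g k \o (fun y : 'rV[R]_n => a k +i* y 0 k : C).
  by apply/funext => y; rewrite /= mxE.
apply: continuous_comp; last exact: cg.
apply: (@continuous_complex _ _ (fun=> a k) (fun y : 'rV[R]_n => y 0 k)).
  exact: cst_continuous.
exact: coord_continuous.
Qed.

Lemma line_cont_kfac n (c : 'I_n -> 'I_3) (phi : 'rV[C]_n -> C) :
  continuous phi ->
  line_cont (fun k => kabs (c k)) (fun z => \prod_k kfac (c k) (z 0 k) * phi z).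
Proof.
move=> cphi.
have cg k t : {for (kabs (c k) +i* t : C), continuous (kfac (c k))}.
  by apply: kfac_continuous; exact: kabs_neq0.
exact: (line_cont_integrand cg cphi).
Qed.

(** The induction evaluates the tail variables first, under the outermost integral; [one_variable]
    then evaluates the head for each fixed tuple of tail angles. *)
Lemma pointwise n (phi : 'rV[C]_n -> C) : sep_entire phi -> periodic phi ->
  \sum_(c : {ffun 'I_n -> 'I_3}) viter (fun k => kabs (c k))
     (fun z => \prod_k kfac (c k) (z 0 k) * phi z) =
  (2 * pi%:C * 'i) ^+ n * \sum_(s : {ffun 'I_n -> S}) phi (\row_k (0 +i* th (s k))).
Proof.
elim: n phi => [|n ih] phi sphi pphi.
  rewrite expr0 mul1r (big_pred1 [ffun=> ord0]); last first.
    by move=> c; apply/esym/eqP/ffunP => -[].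
  rewrite [RHS](big_pred1 (ffun0 (card_ord 0))); last first.
    by move=> c; apply/esym/eqP/ffunP => -[].
  by rewrite /= big_ord0 mul1r; congr phi; apply/rowP => -[].
have [cphi hphi] := sphi.
rewrite !big_ffun_cons.
(* For a fixed class [c0] of the head, the sum over tails moves inside the outer integral, where the
   induction hypothesis applies at each height [t]. *)
have E c0 : \sum_(c : {ffun 'I_n -> 'I_3}) viter (fun k => kabs (fcons c0 c k))
     (fun z => \prod_k kfac (fcons c0 c k) (z 0 k) * phi z) =
   (2 * pi%:C * 'i) ^+ n * \sum_(s : {ffun 'I_n -> S})
     cint (- pi) pi (fun t => kfac c0 (kabs c0 +i* t) *
       phi (row_mx (const_mx (kabs c0 +i* t) : 'rV_1) (\row_k (0 +i* th (s k)))) * 'i).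
  pose V (c : {ffun 'I_n -> 'I_3}) t := viter (fun k => kabs (c k))
     (fun v : 'rV[C]_n => \prod_k kfac (c k) (v 0 k) * phi (row_mx (const_mx (kabs c0 +i* t) : 'rV_1) v)).
  pose W c t := kfac c0 (kabs c0 +i* t) * V c t * 'i.
  have ctail t := @continuous_cons 'rV[C]_n C n (fun=> kabs c0 +i* t) id
     (@cst_continuous _ _ _) (@id_continuous _).
  have hW c : viter (fun k => kabs (fcons c0 c k))
     (fun z => \prod_k kfac (fcons c0 c k) (z 0 k) * phi z) = cint (- pi) pi (W c).
    rewrite viterS fcons0; apply: eq_cint => t _; congr (_ * _).
    rewrite -viterZ; last first.
      apply: line_cont_kfac => v.
      by apply: (@continuous_comp _ _ _ _ phi); [exact: (ctail t)|exact: cphi].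
    have -> : (fun k => kabs (fcons c0 c (lift ord0 k))) = (fun k => kabs (c k)).
      by apply/funext => k; rewrite fconsS.
    apply: eq_viter => v; rewrite big_ord_recl fcons0 row_mx_head !mulrA.
    congr (_ * _ * _); apply: eq_bigr => k _; by rewrite fconsS row_mx_tail.
  have cW c : cont_on (- pi) pi (W c).
    apply: cont_onM; last exact: cont_on_cst.
    apply: cont_onM.
      by apply: cont_on_vline => t _; apply: kfac_continuous; exact: kabs_neq0.
    move=> t _; move: t; apply: (@viter_continuous R n R (fun t v =>
      \prod_k kfac (c k) (v 0 k) * phi (row_mx (const_mx (kabs c0 +i* t) : 'rV_1) v))) => p.
    apply: continuousM.
      (* The choice [phi = 1] extracts the continuity of the product alone. *)
      have cc := @line_cont_kfac n c (fun=> 1) (@cst_continuous _ _ _).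
      have -> : (fun p : R * 'rV[R]_n => \prod_k kfac (c k) (line (fun k => kabs (c k)) p.2 0 k)) =
        (fun t => \prod_k kfac (c k) (line (fun k => kabs (c k)) t 0 k) * 1) \o snd.
        by apply/funext => q /=; rewrite mulr1.
      by apply: continuous_comp; [exact: cvg_snd|exact: cc].
    apply: (@continuous_comp _ _ _ (fun p : R * 'rV[R]_n =>
      row_mx (const_mx (kabs c0 +i* p.1) : 'rV_1) (line (fun k => kabs (c k)) p.2) : 'rV_n.+1) phi).
      apply: (@continuous_cons _ C n (fun p : R * 'rV[R]_n => kabs c0 +i* p.1)
        (fun p => line (fun k => kabs (c k)) p.2)) => q.
        by apply: (@continuous_complex _ _ (fun=> kabs c0) fst); [exact: cst_continuous|exact: cvg_fst].
      by apply: (@continuous_comp _ _ _ snd (line _)); [exact: cvg_snd|exact: continuous_line].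
    exact: cphi.
  under eq_bigr do rewrite hW.
  rewrite -(cint_sum _ cW) mulr_sumr.
  have cQ (s : {ffun 'I_n -> S}) : cont_on (- pi) pi (fun t => kfac c0 (kabs c0 +i* t) *
       phi (row_mx (const_mx (kabs c0 +i* t) : 'rV_1) (\row_k (0 +i* th (s k)))) * 'i).
    apply: (@cont_kfac c0 (fun z => phi (row_mx (const_mx z : 'rV_1) (\row_k (0 +i* th (s k)))))).
    move=> z; apply: (@continuous_comp _ _ _ (fun z : C =>
      row_mx (const_mx z : 'rV_1) (\row_k (0 +i* th (s k))) : 'rV_n.+1) phi).
      by apply: (@continuous_cons _ C n id (fun=> _)) => q; [exact: id_continuous|exact: cst_continuous].
    exact: cphi.
  have cQ' (s : {ffun 'I_n -> S}) := cont_onM (@cont_on_cst _ (- pi) pi ((2 * pi%:C * 'i) ^+ n)) (cQ s).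
  rewrite -(eq_bigr _ (fun s _ => cintZ ((2 * pi%:C * 'i) ^+ n) (cQ s))).
  rewrite -(cint_sum _ cQ'); apply: eq_cint => t _.
  rewrite /W -!mulr_suml -mulr_sumr /V ih; last 2 first.
  - exact: sep_entire_tail.
  - exact: periodic_tail.
  by rewrite -!mulr_sumr -mulr_suml -mulr_sumr; ring.
under eq_bigr do rewrite E.
rewrite -mulr_sumr exchange_big /= exprSr -(mulrA _ (2 * pi%:C * 'i)); congr (_ * _).
rewrite [RHS]mulr_sumr.
(* With the tail angles frozen, the three classes of the head add up by [one_variable]. *)
have F (s : {ffun 'I_n -> S}) : \sum_c cint (- pi) pi (fun t => kfac c (kabs c +i* t) *
       phi (row_mx (const_mx (kabs c +i* t) : 'rV_1) (\row_k (0 +i* th (s k)))) * 'i) =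
   2 * pi%:C * 'i * \sum_s0 phi (row_mx (const_mx (0 +i* th s0) : 'rV_1) (\row_k (0 +i* th (s k)))).
  apply: (@one_variable (fun z => phi (row_mx (const_mx z : 'rV_1) (\row_k (0 +i* th (s k)))))).
    move=> z; have -> : (fun z => phi (row_mx (const_mx z : 'rV_1) (\row_k (0 +i* th (s k))))) =
       (fun z => phi (z *: delta_mx 0 ord0 + (row_mx (const_mx 0 : 'rV_1) (\row_k (0 +i* th (s k))) : 'rV_(n.+1)))).
      by apply/funext => w; rewrite delta_head.
    exact: hphi.
  move=> z; rewrite -[RHS](pphi _ ord0); congr phi.
  by rewrite delta_head [X in _ = X + _]delta_head scalerDl addrAC.
under eq_bigr do rewrite F.
rewrite -!mulr_sumr exchange_big /=; congr (_ * _).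
apply: eq_bigr => s0 _; apply: eq_bigr => s _; congr phi.
apply/rowP => k; rewrite [RHS]mxE; have [j ->|->] := unliftP ord0 k.
  by rewrite row_mx_tail mxE fconsS.
by rewrite row_mx_head fcons0.
Qed.

End Pointwise.

(** * Exchanging the Haar integral and the iterated integral *)

Section RealExchange.
Context {d : measure_display} {T : measurableType d} {R : realType}.
Variable mu : probability T R.
Local Notation leb := (@lebesgue_measure R).

(* A function measurable in x and continuous in t is the limit of its samplings on the grids a + k/(m+1). *)
Lemma measurable_caratheodory (V : T -> R -> R) (a : R) :
  (forall t, measurable_fun setT (V^~ t)) -> (forall x, continuous (V x)) ->
  measurable_fun (setT `*` `[a, +oo[) (fun p : T * R => V p.1 p.2).
Proof.
move=> mV cV.
pose grid m t := a + (Num.truncn ((t - a) * m.+1%:R))%:R / m.+1%:R.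
apply: (@measurable_fun_cvg _ _ _ _ (fun m p => V p.1 (grid m p.2))) => [m|[x t] /= [_ ta]].
  (* On the strip [E k] the grid point is constant, so the sampled function depends on [x] alone. *)
  pose E k : set (T * R) := setT `*` `[a + k%:R / m.+1%:R, a + k.+1%:R / m.+1%:R[.
  have m0 : 0 < m.+1%:R :> R by rewrite ltr0n.
  have mE k : measurable (E k) by apply: measurableX => //; exact: measurable_itv.
  have -> : setT `*` `[a, +oo[ = \bigcup_k E k :> set (T * R).
    apply/seteqP; split => [[x t] /= [_]|[x t] [k _] [_ h]].
      rewrite in_itv /= andbT => ta; exists (Num.truncn ((t - a) * m.+1%:R)) => //.
      split => //=; rewrite in_itv /= -lerBrDl -ltrBlDl.
      have := @truncn_itv R ((t - a) * m.+1%:R); rewrite mulr_ge0 ?subr_ge0//.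
      by move=> /(_ isT); rewrite ler_pdivrMr// ltr_pdivlMr.
    rewrite /= in_itv /= in h; have /andP[h1 _] := h; split => //=.
    by rewrite in_itv /= andbT; apply: le_trans h1; rewrite lerDl divr_ge0.
  apply/measurable_fun_bigcup => // k.
  apply: (@eq_measurable_fun _ _ _ _ _ (fun p : T * R => V p.1 (a + k%:R / m.+1%:R))).
    move=> [x t]; rewrite inE /= => -[_] /=; rewrite in_itv /= => /andP[h1 h2].
    congr (V x (a + _%:R / _)); apply/esym/truncn_def.
    by rewrite -ler_pdivrMr// -ltr_pdivlMr// lerBrDl ltrBlDl h1 h2.
  apply: (@measurable_funTS _ _ _ _ (E k)).
  exact: (measurableT_comp (mV (a + k%:R / m.+1%:R)) measurable_fst).
apply: (@cvg_comp _ _ _ (fun m => grid m t) (V x)); last exact: cV.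
apply/cvgrPdist_lt => e e0; near=> m.
have m0 : 0 < m.+1%:R :> R by rewrite ltr0n.
rewrite in_itv /= andbT in ta.
have := @truncn_itv R ((t - a) * m.+1%:R); rewrite mulr_ge0 ?subr_ge0// => /(_ isT).
rewrite -ler_pdivrMr// -ltr_pdivlMr//.
have -> : (Num.truncn ((t - a) * m.+1%:R)).+1%:R / m.+1%:R =
  (Num.truncn ((t - a) * m.+1%:R))%:R / m.+1%:R + m.+1%:R^-1 :> R.
  by rewrite -natr1 mulrDl mul1r.
have me : m.+1%:R^-1 < e by near: m; exact: near_infty_natSinv_lt (PosNum e0).
rewrite /grid opprD addrA; move: (_ / m.+1%:R) => q /andP[h1 h2].
by rewrite ger0_norm ?subr_ge0//; apply: lt_trans me; rewrite ltrBlDl.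
Unshelve. all: by end_near. Qed.

Variables (V : T -> R -> R) (a b M : R).
Hypothesis ab : a <= b.
Hypothesis mV : forall t, measurable_fun setT (V^~ t).
Hypothesis cV : forall x, continuous (V x).
Hypothesis VM : forall x t, a <= t <= b -> `|V x t| <= M.

Let D : set (T * R) := setT `*` `[a, b].

Let mD : measurable D.
Proof. by apply: measurableX => //; exact: measurable_itv. Qed.

Let mu1 : (mu setT = 1)%E.
Proof. exact: probability_setT. Qed.

Let muT_lty : (mu setT < +oo)%E.
Proof. by rewrite mu1 ltry. Qed.

Let muD_lty : ((mu \x leb)%E D < +oo)%E.
Proof.
rewrite /D product_measure1E//.
have lab : (leb `[a, b]%classic < +oo)%E.
  by rewrite lebesgue_measure_itv /=; case: ifP => _; rewrite ?ltry// -EFinB ltry.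
apply: lte_mul_pinfty; [exact: measure_ge0|exact: fin_num_measure|exact: lab].
Qed.

Let iD : (mu \x leb)%E.-integrable D (EFin \o (fun p : T * R => V p.1 p.2)).
Proof.
apply: measurable_bounded_integrable => //.
- have mE : measurable (setT `*` `[a, +oo[ : set (T * R)).
    by apply: measurableX => //; exact: measurable_itv.
  have DE : D `<=` (setT `*` `[a, +oo[ : set (T * R)).
    move=> [x t] /= [_]; rewrite /= !in_itv /= => /andP[? _]; split => //=.
    by rewrite andbT.
  exact: (measurable_funS mE DE (measurable_caratheodory mV cV)).
- exists M; split; first exact: num_real.
  move=> y My [x t] [_ tab]; rewrite /= in_itv /= in tab.
  by apply: le_trans (VM _ tab) _; exact: ltW.
Qed.

(** Fubini is applied on the full product, with [V] extended by 0 off [D]. *)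
Let iV : (mu \x leb)%E.-integrable setT ((fun p : T * R => (V p.1 p.2)%:E) \_ D).
Proof.
have := (@integrable_mkcond _ _ _ (mu \x leb)%E D (fun p => (V p.1 p.2)%:E) mD).1 iD.
exact.
Qed.

Let iVx x : leb.-integrable `[a, b] (EFin \o V x).
Proof. by apply: integrable_itv => t _; exact: cV. Qed.

Let inner x : (\int[leb]_t ((fun p : T * R => (V p.1 p.2)%:E) \_ D) (x, t))%E =
  (\int[leb]_(t in `[a, b]) V x t)%:E.
Proof.
rewrite /Rintegral fineK; last first.
  by apply: integrable_fin_num => //; exact: iVx.
rewrite [RHS]integral_mkcond; apply: eq_integral => t _.
rewrite /patch; congr (if _ then _ else _).
by apply/idP/idP => /set_mem h; apply/mem_set; [case: h|split].
Qed.

Let inner' t : a <= t <= b -> (\int[mu]_x ((fun p : T * R => (V p.1 p.2)%:E) \_ D) (x, t))%E =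
  (\int[mu]_x V x t)%:E.
Proof.
move=> tab; rewrite /Rintegral fineK; last first.
  apply: integrable_fin_num => //.
  apply: (@measurable_bounded_integrable _ _ _ _ (V^~ t)) => //.
  exists M; split; first exact: num_real.
  by move=> y My x _; apply: le_trans (VM _ tab) _; exact: ltW.
apply: eq_integral => x _; rewrite /patch ifT// inE /D /=; split => //.
Qed.

Lemma measurable_Rintegral_param :
  measurable_fun setT (fun x => \int[leb]_(t in `[a, b]) V x t).
Proof.
have := measurable_fubini_F iV; rewrite /fubini_F.
rewrite (_ : (fun x => _) = EFin \o (fun x => \int[leb]_(t in `[a, b]) V x t)); last first.
  by apply/funext => x; exact: inner.
by move/measurable_EFinP.
Qed.

Lemma Rintegral_exchange :
  \int[mu]_x \int[leb]_(t in `[a, b]) V x t = \int[leb]_(t in `[a, b]) \int[mu]_x V x t.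
Proof.
have := Fubini iV.
rewrite (eq_integral _ _ (fun x _ => inner x)) => H.
rewrite {1}/Rintegral H /Rintegral; congr fine.
rewrite [RHS]integral_mkcond; apply: eq_integral => t _.
rewrite [in RHS]/patch; case: ifPn => [|nt].
  by rewrite inE /= in_itv /= => tab; rewrite inner'.
rewrite (eq_integral (fun=> 0%E)) ?integral0// => x _.
rewrite /patch ifN//; apply: contra nt; rewrite !inE /D /= => -[].
by [].
Qed.

End RealExchange.

(** * Complex-valued integrands and iterated contours *)

Section ComplexExchange.
Context {d : measure_display} {T : measurableType d} {R : realType}.
Variable mu : probability T R.
Local Notation leb := (@lebesgue_measure R).
Local Notation C := R[i].
Local Notation normc := (@ComplexField.Normc.normc R).

Definition cmeas (g : T -> C) :=
  measurable_fun setT (fun x => complex.Re (g x)) /\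
  measurable_fun setT (fun x => complex.Im (g x)).

Let cint_exchange_total (V : T -> R -> C) a b M : a <= b ->
  (forall t, cmeas (V^~ t)) -> (forall x, continuous (V x)) ->
  (forall x t, a <= t <= b -> normc (V x t) <= M) ->
  cmeas (fun x => cint a b (V x)) /\
  Cintegral mu setT (fun x => cint a b (V x)) =
  cint a b (fun t => Cintegral mu setT (V^~ t)).
Proof.
move=> ab mV cV VM.
have mR t : measurable_fun setT (fun x => complex.Re (V x t)) by have [] := mV t.
have mI t : measurable_fun setT (fun x => complex.Im (V x t)) by have [] := mV t.
have cR x : continuous (fun t => complex.Re (V x t)).
  by move=> t; apply: cvgRe; exact: cV.
have cI x : continuous (fun t => complex.Im (V x t)).
  by move=> t; apply: cvgIm; exact: cV.
have MR x t : a <= t <= b -> `|complex.Re (V x t)| <= M.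
  by move=> tab; apply: le_trans (normc_ge_absRe _) (VM _ _ tab).
have MI x t : a <= t <= b -> `|complex.Im (V x t)| <= M.
  by move=> tab; apply: le_trans (normc_ge_absIm _) (VM _ _ tab).
split; first by split; [exact: (measurable_Rintegral_param mu mR cR MR)|
                        exact: (measurable_Rintegral_param mu mI cI MI)].
rewrite /cint /Cintegral /=; congr (_ +i* _).
- exact: (Rintegral_exchange mu mR cR MR).
- exact: (Rintegral_exchange mu mI cI MI).
Qed.

Lemma eq_Cintegral (f g : T -> C) (D : set T) : (forall x, D x -> f x = g x) ->
  Cintegral mu D f = Cintegral mu D g.
Proof.
move=> fg; rewrite /Cintegral; congr (_ +i* _);
  by apply: eq_Rintegral => x /set_mem /fg ->.
Qed.

(** Measurability is available only for [t] in the segment. Clamping [t] to it preserves continuity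
    and leaves the integral unchanged. *)
Lemma cint_exchange (V : T -> R -> C) a b M : a <= b ->
  (forall t, a <= t <= b -> cmeas (V^~ t)) -> (forall x, continuous (V x)) ->
  (forall x t, a <= t <= b -> normc (V x t) <= M) ->
  cmeas (fun x => cint a b (V x)) /\
  Cintegral mu setT (fun x => cint a b (V x)) =
  cint a b (fun t => Cintegral mu setT (V^~ t)).
Proof.
move=> ab mV cV VM.
pose clamp (t : R) := Num.min (Num.max t a) b.
have clampE t : a <= t <= b -> clamp t = t.
  by move=> /andP[ta tb]; rewrite /clamp max_l// min_l.
have clamp_itv t : a <= clamp t <= b.
  by rewrite /clamp le_min le_max lexx orbT ab ge_min lexx orbT.
have cclamp : continuous clamp.
  move=> t; apply: (@continuous_min _ _ (fun t : R => Num.max t a) (fun=> b)).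
    by apply: (@continuous_max _ _ id (fun=> a)); [exact: id_continuous|exact: cst_continuous].
  exact: cst_continuous.
have cV' x : continuous (fun t => V x (clamp t)).
  by move=> t; apply: (@continuous_comp _ _ _ clamp (V x)); [exact: cclamp|exact: cV].
have [] := @cint_exchange_total (fun x t => V x (clamp t)) a b M ab
  (fun t => mV _ (clamp_itv t)) cV' (fun x t _ => VM x _ (clamp_itv t)).
have -> : (fun x => cint a b (fun t => V x (clamp t))) = (fun x => cint a b (V x)).
  by apply/funext => x; apply: eq_cint => t tab; rewrite clampE.
move=> mm ->; split; first exact: mm.
by apply: eq_cint => t tab; rewrite clampE.
Qed.

Lemma cmeas_cst c : cmeas (fun=> c).
Proof. by split; exact: measurable_cst. Qed.

Lemma cmeasD f g : cmeas f -> cmeas g -> cmeas (fun x => f x + g x).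
Proof.
move=> [f1 f2] [g1 g2]; split.
  rewrite (_ : (fun x => _) = (fun x => complex.Re (f x) + complex.Re (g x))).
    exact: measurable_funD.
  by apply/funext => x; case: (f x) (g x) => ? ? [].
rewrite (_ : (fun x => _) = (fun x => complex.Im (f x) + complex.Im (g x))).
  exact: measurable_funD.
by apply/funext => x; case: (f x) (g x) => ? ? [].
Qed.

Lemma cmeasM f g : cmeas f -> cmeas g -> cmeas (fun x => f x * g x).
Proof.
move=> [f1 f2] [g1 g2]; split.
  rewrite (_ : (fun x => _) = (fun x => complex.Re (f x) * complex.Re (g x) -
      complex.Im (f x) * complex.Im (g x))).
    by apply: measurable_funB; exact: measurable_funM.
  by apply/funext => x; case: (f x) (g x) => ? ? [].
rewrite (_ : (fun x => _) = (fun x => complex.Re (f x) * complex.Im (g x) +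
      complex.Im (f x) * complex.Re (g x))).
  by apply: measurable_funD; exact: measurable_funM.
by apply/funext => x; case: (f x) (g x) => ? ? [? ?] /=; ring.
Qed.

Lemma cmeas_sum (I : Type) (r : seq I) (F : I -> T -> C) :
  (forall i, cmeas (F i)) -> cmeas (fun x => \sum_(i <- r) F i x).
Proof.
move=> mF; elim: r => [|i r ih].
  rewrite (_ : (fun x => _) = (fun=> 0)); first exact: cmeas_cst.
  by apply/funext => y; rewrite big_nil.
rewrite (_ : (fun x => _) = (fun x => F i x + \sum_(j <- r) F j x)).
  exact: (cmeasD (mF i) ih).
by apply/funext => y; rewrite big_cons.
Qed.

Lemma cmeas_prod (I : Type) (r : seq I) (F : I -> T -> C) :
  (forall i, cmeas (F i)) -> cmeas (fun x => \prod_(i <- r) F i x).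
Proof.
move=> mF; elim: r => [|i r ih].
  rewrite (_ : (fun x => _) = (fun=> 1)); first exact: cmeas_cst.
  by apply/funext => y; rewrite big_nil.
rewrite (_ : (fun x => _) = (fun x => F i x * \prod_(j <- r) F j x)).
  exact: (cmeasM (mF i) ih).
by apply/funext => y; rewrite big_cons.
Qed.

Lemma cmeas_cvg (F : nat -> T -> C) (f : T -> C) : (forall m, cmeas (F m)) ->
  (forall x, F m x @[m --> \oo] --> f x) -> cmeas f.
Proof.
move=> mF Ff; split.
  apply: (@measurable_fun_cvg _ _ _ _ (fun m x => complex.Re (F m x))) => [m|x _].
    by have [] := mF m.
  by apply: cvgRe; exact: Ff.
apply: (@measurable_fun_cvg _ _ _ _ (fun m x => complex.Im (F m x))) => [m|x _].
  by have [] := mF m.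
by apply: cvgIm; exact: Ff.
Qed.

(** With 1/0 = 0, inversion is the pointwise limit of the continuous functions y / (y^2 + 1/(m+1)),
    which all vanish at 0. *)
Lemma measurable_invr : measurable_fun setT (@GRing.inv R).
Proof.
apply: (@measurable_fun_cvg _ _ _ _ (fun m (y : R) => y / (y ^+ 2 + harmonic m))) => [m|y _].
  have h0 : 0 < harmonic m :> R by rewrite /harmonic invr_gt0 ltr0n.
  have ch : continuous (fun y : R => y / (y ^+ 2 + harmonic m)).
    move=> y; apply: (@continuousM R R (fun y => y) (fun y => (y ^+ 2 + harmonic m)^-1)).
      exact: id_continuous.
    apply: continuousV; first by rewrite gt_eqF// ltr_wpDl// sqr_ge0.
    apply: continuousD; last exact: cst_continuous.
    exact: exprn_continuous.
  exact: continuous_measurable_fun ch.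
have [->|y0] := eqVneq y 0.
  rewrite invr0 (_ : (fun m => _) = (fun=> 0)); first exact: cvg_cst.
  by apply/funext => m; rewrite mul0r.
rewrite -[X in _ --> X](_ : y / (y ^+ 2 + 0) = y^-1); last by field.
apply: cvgM; first exact: cvg_cst.
apply: cvgV; first by rewrite addr0 sqrf_eq0.
by apply: cvgD; [exact: cvg_cst|exact: cvg_harmonic].
Qed.

Lemma cmeasV f : cmeas f -> cmeas (fun x => (f x)^-1).
Proof.
move=> [f1 f2].
have mN : measurable_fun setT (fun x => (complex.Re (f x) ^+ 2 + complex.Im (f x) ^+ 2)^-1).
  apply: (measurableT_comp measurable_invr).
  by apply: measurable_funD; exact: measurable_funX.
split.
  rewrite (_ : (fun x => _) = (fun x => complex.Re (f x) *
      (complex.Re (f x) ^+ 2 + complex.Im (f x) ^+ 2)^-1)).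
    exact: measurable_funM.
  by apply/funext => x; case: (f x).
rewrite (_ : (fun x => _) = (fun x => 0 - (complex.Im (f x) *
      (complex.Re (f x) ^+ 2 + complex.Im (f x) ^+ 2)^-1))).
  by apply: measurable_funB; [exact: measurable_cst|exact: measurable_funM].
by apply/funext => x; case: (f x) => u v /=; rewrite sub0r ?mulNr.
Qed.

Lemma Re_integrable (f : T -> C) M : cmeas f -> (forall x, normc (f x) <= M) ->
  mu.-integrable setT (EFin \o (fun x => complex.Re (f x))).
Proof.
move=> [f1 _] fM; apply: measurable_bounded_integrable => //.
  by apply: le_lt_trans (probability_le1 mu measurableT) _; rewrite ltry.
exists M; split; first exact: num_real.
move=> y My x _; apply: le_trans (normc_ge_absRe _) _.
by apply: le_trans (fM x) _; exact: ltW.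
Qed.

Lemma Im_integrable (f : T -> C) M : cmeas f -> (forall x, normc (f x) <= M) ->
  mu.-integrable setT (EFin \o (fun x => complex.Im (f x))).
Proof.
move=> [_ f1] fM; apply: measurable_bounded_integrable => //.
  by apply: le_lt_trans (probability_le1 mu measurableT) _; rewrite ltry.
exists M; split; first exact: num_real.
move=> y My x _; apply: le_trans (normc_ge_absIm _) _.
by apply: le_trans (fM x) _; exact: ltW.
Qed.

Lemma CintegralD (f g : T -> C) M1 M2 : cmeas f -> cmeas g ->
  (forall x, normc (f x) <= M1) -> (forall x, normc (g x) <= M2) ->
  Cintegral mu setT (fun x => f x + g x) = Cintegral mu setT f + Cintegral mu setT g.
Proof.
move=> mf mg fM gM; rewrite /Cintegral.
have -> : (fun x => complex.Re (f x + g x)) =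
          (fun x => complex.Re (f x) + complex.Re (g x)).
  by apply/funext => t; case: (f t) (g t) => ? ? [].
have -> : (fun x => complex.Im (f x + g x)) =
          (fun x => complex.Im (f x) + complex.Im (g x)).
  by apply/funext => t; case: (f t) (g t) => ? ? [].
rewrite (RintegralD _ (Re_integrable mf fM) (Re_integrable mg gM))//.
by rewrite (RintegralD _ (Im_integrable mf fM) (Im_integrable mg gM)).
Qed.

Lemma CintegralZ c (f : T -> C) M : cmeas f -> (forall x, normc (f x) <= M) ->
  Cintegral mu setT (fun x => c * f x) = c * Cintegral mu setT f.
Proof.
move=> mf fM; rewrite /Cintegral; case: c => u v.
have iR := Re_integrable mf fM; have iI := Im_integrable mf fM.
have -> : (fun t => complex.Re ((u +i* v) * f t)) =
          (fun t => u * complex.Re (f t) - v * complex.Im (f t)).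
  by apply/funext => t; case: (f t).
have -> : (fun t => complex.Im ((u +i* v) * f t)) =
          (fun t => u * complex.Im (f t) + v * complex.Re (f t)).
  by apply/funext => t; case: (f t).
have Z r (g : T -> R) : mu.-integrable setT (EFin \o g) ->
    mu.-integrable setT (EFin \o (fun t => r * g t)).
  by move=> ig; exact: (@integrableZl _ _ _ mu _ measurableT r _ ig).
rewrite RintegralB// ?RintegralD//; try exact: Z.
by rewrite !RintegralZl.
Qed.

Lemma normc_sum (I : Type) (r : seq I) (F : I -> C) :
  normc (\sum_(i <- r) F i) <= \sum_(i <- r) normc (F i).
Proof.
elim: r => [|i r ih]; first by rewrite !big_nil ComplexField.Normc.normc0.
by rewrite !big_cons; apply: le_trans (normcD _ _) _; rewrite lerD2l.
Qed.

Lemma Cintegral_sum (I : Type) (r : seq I) (F : I -> T -> C) (M : I -> R) :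
  (forall i, cmeas (F i)) -> (forall i x, normc (F i x) <= M i) ->
  Cintegral mu setT (fun x => \sum_(i <- r) F i x) = \sum_(i <- r) Cintegral mu setT (F i).
Proof.
move=> mF FM; elim: r => [|i r ih].
  rewrite big_nil (_ : (fun x => _) = (fun=> 0)); last first.
    by apply/funext => y; rewrite big_nil.
  by rewrite /Cintegral /= !Rintegral_cst// mul0r.
rewrite big_cons -ih (_ : (fun x => _) = (fun x => F i x + \sum_(j <- r) F j x)); last first.
  by apply/funext => y; rewrite big_cons.
apply: (@CintegralD _ _ (M i) (\sum_(j <- r) M j)) => //; first exact: cmeas_sum.
by move=> x; apply: le_trans (normc_sum _ _) _; apply: ler_sum => j _; exact: FM.
Qed.

(** Each integration contributes 2 (from [cint_norm]) times the length 2 pi. *)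
Lemma viter_norm n (a : 'I_n -> R) (h : 'rV[C]_n -> C) M : line_cont a h ->
  (forall t : 'rV[R]_n, (forall k, - pi <= t 0 k <= pi) -> normc (h (line a t)) <= M) ->
  normc (viter a h) <= (4 * pi) ^+ n * M.
Proof.
elim: n a h => [|n ih] a h ch hM.
  rewrite expr0 mul1r /=; have -> : (0 : 'rV[C]_0) = line a 0 by apply/rowP => -[].
  by apply: hM => -[].
have pi0 := pi_ge0 R.
rewrite viterS; apply: le_trans (@cint_norm _ (- pi) pi ((4 * pi) ^+ n * M) _ _ _ _) _.
- by lra.
- move=> t _; apply: continuousM; last exact: cst_continuous.
  exact: line_cont_cons.
- move=> t tpi; rewrite ComplexField.Normc.normcM.
  have -> : normc 'i = 1 by rewrite /= expr0n expr1n add0r sqrtr1.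
  rewrite mulr1; apply: ih; first exact: line_cont_tail.
  move=> t' t'pi; rewrite -line_cons; apply: hM => k.
  by have [j ->|->] := unliftP ord0 k; rewrite ?row_mx_tail ?row_mx_head.
- by rewrite exprS le_eqVlt; apply/orP; left; apply/eqP; ring.
Qed.

(** The assumptions concern only heights in the box, since the bound on the integrand will come from
    compactness of the box. *)
Lemma viter_exchange n (a : 'I_n -> R) (W : T -> 'rV[C]_n -> C) M :
  (forall t : 'rV[R]_n, (forall k, - pi <= t 0 k <= pi) -> cmeas (fun x => W x (line a t))) ->
  (forall x, line_cont a (W x)) ->
  (forall x (t : 'rV[R]_n), (forall k, - pi <= t 0 k <= pi) -> normc (W x (line a t)) <= M) ->
  cmeas (fun x => viter a (W x)) /\
  Cintegral mu setT (fun x => viter a (W x)) =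
  viter a (fun z => Cintegral mu setT (fun x => W x z)).
Proof.
have pi0 := pi_ge0 R.
elim: n a W => [|n ih] a W mW cW WM.
  split=> //=; have -> : (0 : 'rV[C]_0) = line a 0 by apply/rowP => -[].
  by apply: mW => -[].
pose W' t x (v : 'rV[C]_n) := W x (row_mx (const_mx (a ord0 +i* t) : 'rV_1) v).
pose V x t := viter (fun k => a (lift ord0 k)) (W' t x).
have box t (t' : 'rV[R]_n) : - pi <= t <= pi -> (forall k, - pi <= t' 0 k <= pi) ->
    forall k, - pi <= (row_mx (const_mx t : 'rV_1) t' : 'rV_n.+1) 0 k <= pi.
  by move=> tpi t'pi k; have [j ->|->] := unliftP ord0 k; rewrite ?row_mx_tail ?row_mx_head.
have cW' t x : line_cont (fun k => a (lift ord0 k)) (W' t x) by exact: line_cont_tail.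
have VM x t : - pi <= t <= pi -> normc (V x t) <= (4 * pi) ^+ n * M.
  move=> tpi; apply: viter_norm => // t' t'pi; rewrite /W' -line_cons.
  by apply: WM; exact: box.
have cV x : continuous (V x) by exact: line_cont_cons.
have IH t : - pi <= t <= pi -> cmeas (V^~ t) /\
    Cintegral mu setT (V^~ t) = viter (fun k => a (lift ord0 k))
      (fun z => Cintegral mu setT (fun x => W' t x z)).
  move=> tpi; apply: ih => // [t' t'pi|x t' t'pi].
    have -> : (fun x => W' t x (line (fun k => a (lift ord0 k)) t')) =
       (fun x => W x (line a (row_mx (const_mx t : 'rV_1) t'))).
      by apply/funext => x; rewrite line_cons.
    by apply: mW; exact: box.
  by rewrite /W' -line_cons; apply: WM; exact: box.
have ni : normc 'i = 1 by rewrite /= expr0n expr1n add0r sqrtr1.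
have [||||mVi eVi] := @cint_exchange (fun x t => V x t * 'i) (- pi) pi ((4 * pi) ^+ n * M).
- by lra.
- by move=> t /IH[mVt _]; apply: cmeasM => //; exact: cmeas_cst.
- by move=> x t; apply: continuousM; [exact: cV|exact: cst_continuous].
- by move=> x t tpi; rewrite ComplexField.Normc.normcM ni mulr1; exact: VM.
split; first exact: mVi.
rewrite viterS [LHS]eVi; apply: eq_cint => t tpi.
have [mVt eVt] := IH t tpi; rewrite -eVt [RHS]mulrC -(CintegralZ 'i mVt (fun x => VM x t tpi)).
by apply: eq_Cintegral => x _; rewrite mulrC.
Qed.

End ComplexExchange.

(** * Logarithmic derivative of the characteristic polynomial *)

Section Characteristic.
Context {R : realType}.
Local Notation C := R[i].
Local Notation normc := (@ComplexField.Normc.normc R).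
Local Open Scope sesquilinear_scope.

Lemma continuous_hornerC (p : {poly C}) : continuous (fun z : C => p.[z]).
Proof.
elim/poly_ind: p => [|p c ih] z.
  rewrite (_ : (fun w => _) = (fun=> 0)); first exact: cst_continuous.
  by apply/funext => w; rewrite horner0.
rewrite (_ : (fun w => _) = (fun w => p.[w] * w + c)).
  have c1 : {for z, continuous (fun w : C => p.[w] * w)}.
    have := @id_continuous C z; exact: (continuousM (ih z)).
  have c2 : {for z, continuous (fun w : C => c)} by exact: cst_continuous.
  exact: (continuousD c1 c2).
by apply/funext => w; rewrite hornerMXaddC.
Qed.

(** The difference quotient is itself a polynomial, hence continuous; this yields the analytic
    derivative and its approximation by increments. *)
Lemma horner_quotient (p : {poly C}) (w : C) : exists2 q : {poly C},
  forall z, p.[z] - p.[w] = (z - w) * q.[z] & q.[w] = p^`().[w].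
Proof.
have /factor_theorem[q qE] : root (p - p.[w]%:P) w.
  by rewrite /root !hornerE subrr.
exists q => [z|].
  have := congr1 (horner^~ z) qE; rewrite !hornerE => ->; exact: mulrC.
have := congr1 (fun r : {poly C} => r^`().[w]) qE.
by rewrite derivB derivC subr0 derivM derivXsubC !hornerE subrr mulr0 add0r => ->.
Qed.

Lemma derive1_horner (p : {poly C}) (w : C) : derive1 (fun z : C => p.[z]) w = p^`().[w].
Proof.
have [q qE <-] := horner_quotient p w.
apply: cvg_lim => //.
have cq : {for 0, continuous (fun h : C => q.[h + w])}.
  apply: (@continuous_comp C C C (fun h => h + w) (fun z => q.[z])).
    exact: holo_continuous (holoD (holo_id 0) (holo_cst w 0)).
  exact: continuous_hornerC.
apply/(cvgcP (F := dnbhs (0 : C))) => e e0.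
have H := (cvgcP (F := nbhs (0 : C)) _ _).1 cq _ e0.
rewrite /dnbhs near_withinE; near=> h => h0.
have : normc (q.[0 + w] - q.[h + w]) < e by near: h; exact: H.
by rewrite add0r qE addrK /GRing.scale /= mulrA mulVf// mul1r.
Unshelve. all: by end_near. Qed.

Lemma Lambda_horner m (X : 'M[C]_m) : exists p : {poly C}, forall w, Lambda X w = p.[w].
Proof.
exists (\det (1%:M - 'X *: map_mx polyC (X^t*))) => w.
rewrite -[RHS]/(horner_eval w _) -det_map_mx; congr (\det _).
apply/matrixP => i j; rewrite !mxE.
by rewrite -[RHS]/(_.[w]) hornerD hornerN hornerM hornerX hornerC hornerMn hornerC.
Qed.

Lemma char_poly_horner m (X : 'M[C]_m) w : (char_poly X).[w] = \det (w%:M - X).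
Proof.
rewrite -[LHS]/(horner_eval w _) /char_poly -det_map_mx; congr (\det _).
apply/matrixP => i j; rewrite !mxE.
by rewrite -[LHS]/(_.[w]) hornerD hornerN hornerMn hornerX hornerC.
Qed.

Lemma conj_Lambda m (X : 'M[C]_m) w : conjc (Lambda X w) = \det (1%:M - conjc w *: X).
Proof.
rewrite -det_tr /Lambda -[LHS]/((conjc : {rmorphism C -> C}) _) -det_map_mx.
congr (\det _); apply/matrixP => i j; rewrite !mxE /=.
rewrite rmorphB rmorphM /= rmorph_nat eq_sym; congr (_ - _ * _).
exact: conjcK.
Qed.

(** For [u] the conjugate of [w] and [u != 0], det (1 - u X) is u^m times the characteristic
    polynomial at 1/u. *)
Lemma Lambda_of_char_poly m (X : 'M[C]_m) (S : finType) (lam : S -> C) :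
  #|S| = m -> char_poly X = \prod_s ('X - (lam s)%:P) ->
  forall w, Lambda X w = \prod_s (1 - w * conjc (lam s)).
Proof.
move=> Sm cX w; apply: (can_inj (@conjcK R)).
rewrite conj_Lambda rmorph_prod /=.
have [->|w0] := eqVneq w 0.
  rewrite conjc0 scale0r subr0 det1 big1// => s _.
  by rewrite mul0r subr0 rmorph1.
have u0 : conjc w != 0 by rewrite conjc_eq0.
rewrite (_ : 1%:M - _ = conjc w *: ((conjc w)^-1%:M - X)); last first.
  by rewrite scalerBr scale_scalar_mx mulfV.
rewrite detZ -char_poly_horner cX horner_prod -Sm -prodr_const -big_split /=.
apply: eq_bigr => s _; rewrite !hornerE mulrBr mulfV//.
by rewrite rmorphB rmorph1 /= rmorphM /= conjcK.
Qed.

Definition jfac m (X : 'M[C]_m) (a : C) : C :=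
  - cexp (- a) * (derive1 (Lambda X) (cexp (- a)) / Lambda X (cexp (- a))).

Lemma deriv_prod_linear (S : Type) (r : seq S) (l : S -> C) w :
  (forall s, 1 - l s * w != 0) ->
  (\prod_(s <- r) (1 - l s *: 'X))^`().[w] =
  (\prod_(s <- r) (1 - l s *: 'X)).[w] * \sum_(s <- r) (- l s / (1 - l s * w)).
Proof.
move=> lw; elim: r => [|s r ih].
  by rewrite !big_nil derivC hornerE mulr0.
rewrite !big_cons derivM derivB derivZ derivX derivC sub0r hornerD !hornerM ih.
rewrite !(hornerD, hornerN, hornerZ, hornerX, hornerC).
move: (lw s) (\sum_(j <- r) _) (_.[w]) => ls A B.
by field.
Qed.

(** The prefactor - e^{-z} turns each logarithmic derivative - l / (1 - l e^{-z}) into l / (e^z -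
    l). *)
Lemma jfac_sum m (X : 'M[C]_m) (S : finType) (lam : S -> C) z :
  (forall w, Lambda X w = \prod_s (1 - w * lam s)) ->
  (forall s, cexp z - lam s != 0) ->
  jfac X z = \sum_s lam s / (cexp z - lam s).
Proof.
move=> LX zl; set w := cexp (- z); have z0 := cexp_neq0 z.
have wE : w = (cexp z)^-1 by rewrite /w cexpN.
have lw s : 1 - lam s * w != 0.
  rewrite (_ : _ - _ = (cexp z - lam s) / cexp z) ?mulf_neq0 ?invr_eq0//.
  by rewrite wE mulrBl mulfV.
have LE : Lambda X = (fun w => (\prod_s (1 - lam s *: 'X)).[w]).
  apply/funext => v; rewrite LX horner_prod; apply: eq_bigr => s _.
  by rewrite !hornerE mulrC.
rewrite /jfac -/w LE derive1_horner deriv_prod_linear//.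
have P0 : (\prod_s (1 - lam s *: 'X)).[w] != 0.
  by rewrite horner_prod; apply/prodf_neq0 => s _; rewrite !hornerE.
rewrite mulrAC divff// mul1r mulr_sumr; apply: eq_bigr => s _.
move: (zl s) (lw s); rewrite wE; move: (cexp z) (lam s) z0 => u l u0 ul lu.
by field; rewrite ?u0 ?ul ?lu.
Qed.

End Characteristic.

(** * Measurability in the matrix *)

Section BorelMatrices.
Context {R : realType} {m : nat}.
Local Notation C := R[i].
Local Notation bT := (borel_mx R m).
Local Open Scope sesquilinear_scope.

Lemma measurable_continuous_mx (g : 'M[C]_m -> R) : continuous g ->
  measurable_fun setT (g : bT -> R).
Proof.
move=> cg; apply: (measurability _ (RGenOInfty.measurableE R)).
move=> /= _ [_ [a ->]] <-; rewrite setTI; apply: sub_sigma_algebra.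
by move/continuousP : cg; apply; exact: interval_open.
Qed.

Lemma cmeas_entry i j : cmeas (fun X : bT => (X : 'M[C]_m) i j).
Proof.
have cX : continuous (fun X : 'M[C]_m => X i j) by exact: coord_continuous.
split; apply: measurable_continuous_mx => X.
  by apply: (@continuous_comp _ _ _ (fun X : 'M[C]_m => X i j) (@complex.Re R)); [exact: cX|exact: continuous_Re].
by apply: (@continuous_comp _ _ _ (fun X : 'M[C]_m => X i j) (@complex.Im R)); [exact: cX|exact: continuous_Im].
Qed.

Lemma cmeas_conj (f : bT -> C) : cmeas f -> cmeas (fun X => Num.conj (f X)).
Proof.
move=> [f1 f2]; split.
  rewrite (_ : (fun x => _) = (fun x => complex.Re (f x)))//.
  by apply/funext => x; case: (f x).
rewrite (_ : (fun x => _) = (fun x => 0 - complex.Im (f x))).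
  by apply: measurable_funB => //; exact: measurable_cst.
by apply/funext => x; case: (f x) => u v /=; rewrite sub0r.
Qed.

Lemma cmeas_Lambda w : cmeas (fun X : bT => Lambda (X : 'M[C]_m) w).
Proof.
rewrite /Lambda /determinant.
apply: cmeas_sum => s; apply: cmeasM; first exact: cmeas_cst.
apply: cmeas_prod => i.
rewrite (_ : (fun X : bT => _) = (fun X : bT => (i == perm.fun_of_perm s i)%:R + - w * Num.conj ((X : 'M[C]_m) (perm.fun_of_perm s i) i))).
  apply: cmeasD; first exact: cmeas_cst.
  by apply: cmeasM; [exact: cmeas_cst|exact: cmeas_conj (cmeas_entry _ _)].
by apply/funext => X; rewrite !mxE mulNr.
Qed.

(** A pointwise limit of difference quotients with increments 1/(k+1); it exists for every X because
    [Lambda X] is a polynomial. *)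
Lemma cmeas_derive1_Lambda w : cmeas (fun X : bT => derive1 (Lambda (X : 'M[C]_m)) w).
Proof.
pose h k : C := (harmonic k)%:C.
have h0 k : h k != 0.
  by rewrite /h fmorph_eq0 /harmonic invr_eq0 pnatr_eq0.
apply: (@cmeas_cvg _ _ _ (fun k (X : bT) => (h k)^-1 *
   (Lambda (X : 'M[C]_m) (h k + w) + - 1 * Lambda (X : 'M[C]_m) w))) => [k|X].
  apply: cmeasM; first exact: cmeas_cst.
  apply: cmeasD; first exact: cmeas_Lambda.
  by apply: cmeasM; [exact: cmeas_cst|exact: cmeas_Lambda].
have [p pE] := Lambda_horner (X : 'M[C]_m).
have -> : Lambda (X : 'M[C]_m) = (fun w => p.[w]) by apply/funext.
rewrite derive1_horner; have [q qE <-] := horner_quotient p w.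
rewrite (_ : (fun k => _) = (fun k => q.[h k + w])); last first.
  apply/funext => k; rewrite mulN1r qE addrK mulrA mulVf// mul1r.
  by [].
apply: (@continuous_cvg _ _ _ _ _ (fun k => h k + w) (fun z => q.[z])).
  exact: continuous_hornerC.
rewrite -[X in _ --> X]add0r; apply: cvgD; last exact: cvg_cst.
by apply: (@cvg_complex _ _ _ _ harmonic (fun=> 0)); [exact: cvg_harmonic|exact: cvg_cst].
Qed.

Lemma cmeas_jfac a : cmeas (fun X : bT => jfac (X : 'M[C]_m) a).
Proof.
apply: cmeasM; first exact: cmeas_cst.
apply: cmeasM; first exact: cmeas_derive1_Lambda.
by apply: cmeasV; exact: cmeas_Lambda.
Qed.

Lemma measurable_zeros (I : finType) (F : I -> bT -> C) : (forall i, cmeas (F i)) ->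
  measurable [set X | forall i, F i X = 0].
Proof.
move=> mF.
rewrite (_ : [set X | _] = \bigcap_(i in [set: I])
   ([set X | complex.Re (F i X) = 0] `&` [set X | complex.Im (F i X) = 0])).
  apply: fin_bigcap_measurable => // i _; have [m1 m2] := mF i.
  by apply: measurableI; rewrite -[X in measurable X]setTI;
    [exact: (m1 measurableT [set 0])|exact: (m2 measurableT [set 0])].
apply/seteqP; split => [X FX i _ /=|X FX i]; first by rewrite FX.
have [h1 h2] := FX i Logic.I; apply/eqP; rewrite eq_complex.
by rewrite /= in h1 h2; rewrite h1 h2 !eqxx.
Qed.

End BorelMatrices.

Section UnitarySymplectic.
Context {R : realType} {N : nat}.
Local Notation C := R[i].
Local Open Scope sesquilinear_scope.

Lemma cmeas_mulmx m (A B : borel_mx R m -> 'M[C]_m) :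
  (forall i j, cmeas (fun X => A X i j)) -> (forall i j, cmeas (fun X => B X i j)) ->
  forall i j, cmeas (fun X => (A X *m B X) i j).
Proof.
move=> mA mB i j.
rewrite (_ : (fun X => _) = (fun X => \sum_k A X i k * B X k j)).
  by apply: cmeas_sum => k; exact: cmeasM.
by apply/funext => X; rewrite mxE.
Qed.

(** The group is the common zero set of finitely many measurable functions, the entries of its two
    defining equations. *)
Lemma measurable_USp : measurable (USp R N : set (borel_mx R (N + N))).
Proof.
pose F (p : bool * ('I_(N + N) * 'I_(N + N))) (X : borel_mx R (N + N)) : C :=
  if p.1 then ((X : 'M[C]_(N + N)) *m X^t*) p.2.1 p.2.2 + - (1%:M : 'M[C]_(N + N)) p.2.1 p.2.2
  else (X^T *m symplectic_form R N *m X) p.2.1 p.2.2 + - symplectic_form R N p.2.1 p.2.2.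
rewrite (_ : USp R N = [set X | forall p, F p X = 0]).
  apply: measurable_zeros => -[[] [i j]]; rewrite /F /=.
    apply: cmeasD; last exact: cmeas_cst.
    apply: cmeas_mulmx => k l; first exact: cmeas_entry.
    rewrite (_ : (fun X => _) = (fun X : borel_mx R (N + N) => Num.conj ((X : 'M[C]_(N + N)) l k))).
      exact: cmeas_conj (cmeas_entry _ _).
    by apply/funext => X; rewrite !mxE.
  apply: cmeasD; last exact: cmeas_cst.
  apply: cmeas_mulmx => k l; last exact: cmeas_entry.
  apply: (@cmeas_mulmx _ (fun X => (X : 'M[C]_(N + N))^T) (fun=> symplectic_form R N)) => i' j'.
    rewrite (_ : (fun X => _) = (fun X : borel_mx R (N + N) => (X : 'M[C]_(N + N)) j' i')).
      exact: cmeas_entry.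
    by apply/funext => X; rewrite mxE.
  exact: cmeas_cst.
apply/seteqP; split => [X [/unitarymxP X1 X2] [[] [i j]]|X FX].
- by rewrite /F /= X1 subrr.
- by rewrite /F /= X2 subrr.
split.
  apply/unitarymxP/matrixP => i j; apply/eqP; rewrite -subr_eq0; apply/eqP.
  exact: (FX (true, (i, j))).
apply/matrixP => i j; apply/eqP; rewrite -subr_eq0; apply/eqP.
exact: (FX (false, (i, j))).
Qed.

End UnitarySymplectic.

(** * Eigenangles and ordered partitions *)

Section SignedAngles.
Context {R : realType} {N : nat}.
Local Notation C := R[i].
Local Notation normc := (@ComplexField.Normc.normc R).

(** The 2N eigenangles; the boolean [true] marks the negated one. *)
Definition signed (t : 'I_N -> R) (s : 'I_N * bool) : R := (-1) ^+ s.2 * t s.1.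

Definition flip (s : 'I_N * bool) := (s.1, ~~ s.2).

Lemma flipK : involutive flip.
Proof. by case=> j b; rewrite /flip negbK. Qed.

Lemma signed_flip t s : signed t (flip s) = - signed t s.
Proof.
by case: s => j []; rewrite /signed /= !(expr0, expr1, mulN1r, mul1r) ?opprK.
Qed.

Lemma signed_pi t s : (forall j, 0 <= t j <= pi) -> - pi <= signed t s <= pi.
Proof.
move=> tpi; have := tpi s.1; rewrite /signed; case: s.2 => /=;
  rewrite !(expr0, expr1, mulN1r, mul1r); lra.
Qed.

Variables (X : 'M[C]_(N + N)) (t : 'I_N -> R).
Hypothesis chiX : char_poly X =
  \prod_(j < N) (('X - (cexp (0 +i* t j))%:P) * ('X - (cexp (0 -i* t j))%:P)).

(** The conjugate eigenvalues of [Lambda_of_char_poly] are the eigenvalues again, reindexed by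
    [flip]. *)
Lemma Lambda_signed w : Lambda X w = \prod_s (1 - w * cexp (0 +i* signed t s)).
Proof.
rewrite (@Lambda_of_char_poly _ _ X _ (fun s => cexp (0 +i* signed t s))).
- rewrite (reindex_inj (inv_inj flipK)); apply: eq_bigr => s _ /=.
  rewrite signed_flip; congr (1 - w * _); apply/eqP.
  by rewrite eq_complex /= cosN sinN mulrN opprK !eqxx.
- by rewrite card_prod card_ord card_bool muln2 addnn.
- rewrite chiX -(pair_bigA _ (fun j b => 'X - (cexp (0 +i* signed t (j, b)))%:P)) /=.
  apply: eq_bigr => j _; rewrite big_bool mulrC /signed /=.
  by rewrite expr0 expr1 mul1r mulN1r.
Qed.

Lemma jfac_hsum a : complex.Re a != 0 -> jfac X a = hsum (signed t) a.
Proof.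
move=> a0; rewrite (jfac_sum Lambda_signed) // => s.
by apply: cexp_neq_unit => //; exact: lam1.
Qed.

End SignedAngles.

(** Each tuple of indices carries 2^n sign patterns: the origin of the factor 2^n in the theorem. *)
Lemma sum_ffun_signed (A : finType) (V : nmodType) n (F : {ffun 'I_n -> A * bool} -> V)
    (G : {ffun 'I_n -> A} -> V) :
  (forall s, F s = G [ffun k => (s k).1]) ->
  \sum_s F s = (\sum_j G j) *+ 2 ^ n.
Proof.
move=> FG; pose mk (p : {ffun 'I_n -> A} * {ffun 'I_n -> bool}) :=
  [ffun k => (p.1 k, p.2 k)].
rewrite (reindex mk) /=; last first.
  exists (fun s => ([ffun k => (s k).1], [ffun k => (s k).2])) => [[j b]|s] _ /=.
    by congr pair; apply/ffunP => k; rewrite !ffunE.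
  by apply/ffunP => k; rewrite !ffunE -surjective_pairing.
rewrite -(pair_bigA _ (fun j b => F (mk (j, b)))) /= -sumrMnl.
apply: eq_bigr => j _; rewrite (eq_bigr (fun=> G j)); last first.
  by move=> b _; rewrite FG; congr G; apply/ffunP => k; rewrite !ffunE.
by rewrite sumr_const card_ffun card_bool card_ord.
Qed.

Section OrderedPartitions.
Variable n : nat.

Definition fibre (c : {ffun 'I_n -> 'I_3}) (m : nat) : {set 'I_n} :=
  [set k | val (c k) == m].

Lemma sum_ordered_partitions (V : nmodType)
    (F : {set 'I_n} -> {set 'I_n} -> {set 'I_n} -> V) :
  \sum_(K : {set 'I_n}) \sum_(L : {set 'I_n})
    \sum_(M : {set 'I_n} |
       [&& [disjoint K & L], [disjoint K & M], [disjoint L & M] &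
           K :|: L :|: M == [set: 'I_n]%SET]) F K L M =
  \sum_c F (fibre c 0) (fibre c 1) (fibre c 2).
Proof.
rewrite pair_big /= pair_big_dep /=.
(* The code does not look at [M], which the constraints force to be the complement of the union of
   [K] and [L]. *)
pose code (K L : {set 'I_n}) : {ffun 'I_n -> 'I_3} :=
  [ffun k => if k \in K then 0 else if k \in L then 1 else 2%:R].
rewrite (reindex (fun c => ((fibre c 0, fibre c 1), fibre c 2))) /=; last first.
  exists (fun q => code q.1.1 q.1.2).
    move=> c _; apply/ffunP => k; rewrite ffunE !inE; apply/val_inj.
    by case: (c k) => -[|[|[|]]].
  move=> [[K L] M]; rewrite inE /= => /and4P[KL KM LM /eqP U].
  have U' k : [|| k \in K, k \in L | k \in M].
    by have /setP/(_ k) := U; rewrite !inE -orbA.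
  congr ((_, _), _); apply/setP => k; rewrite inE ffunE; have := U' k.
  - by case: (k \in K) => //; case: (k \in L).
  - have [kK|] := boolP (k \in K); first by rewrite (disjointFr KL kK).
    by case: (k \in L).
  - have [kK|] := boolP (k \in K); first by rewrite (disjointFr KM kK).
    have [kL|] := boolP (k \in L); first by rewrite (disjointFr LM kL).
    by move=> _ _ /= ->.
apply: eq_bigl => c; apply/and4P; split.
- by rewrite disjoint_subset; apply/fintype.subsetP => k; rewrite !inE => /eqP->.
- by rewrite disjoint_subset; apply/fintype.subsetP => k; rewrite !inE => /eqP->.
- by rewrite disjoint_subset; apply/fintype.subsetP => k; rewrite !inE => /eqP->.
- by apply/eqP/setP => k; rewrite !inE; case: (c k) => -[|[|[|]]].
Qed.

End OrderedPartitions.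

(** * Uniform bounds and restriction to the group *)

Section Bounds.
Context {R : realType}.
Local Notation C := R[i].
Local Notation normc := (@ComplexField.Normc.normc R).

Lemma normc_prod_le (I : finType) (F : I -> C) B :
  (forall i, normc (F i) <= B) -> normc (\prod_i F i) <= B ^+ #|I|.
Proof.
move=> FB; rewrite (big_morph normc (@ComplexField.Normc.normcM R) (@ComplexField.Normc.normc1 R)).
by rewrite -prodr_const; apply: ler_prod => i _; rewrite normc_ge0 FB.
Qed.

Lemma bounded_on_box n (g : 'rV[R]_n -> R) a b : continuous g ->
  exists M, forall t : 'rV[R]_n, (forall k, a <= t 0 k <= b) -> `|g t| <= M.
Proof.
move=> cg.
have := compact_bounded (continuous_compact (continuous_subspaceT cg)
  (@rV_compact R n (fun=> `[a, b]%classic) (fun=> @segment_compact R a b))).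
move=> [M [_ HM]]; exists (M + 1) => t tab.
apply: (HM (M + 1)); first by rewrite ltrDl.
by exists t => // k; rewrite /= in_itv; exact: tab.
Qed.

Lemma normc_bounded_on_box n (g : 'rV[R]_n -> C) a b : continuous g ->
  exists M, forall t : 'rV[R]_n, (forall k, a <= t 0 k <= b) -> normc (g t) <= M.
Proof.
move=> cg.
have cR : continuous (fun t => complex.Re (g t)) 
  by move=> t; apply: (@continuous_comp _ _ _ g (@complex.Re R)); [exact: cg|exact: continuous_Re].
have cI : continuous (fun t => complex.Im (g t)) 
  by move=> t; apply: (@continuous_comp _ _ _ g (@complex.Im R)); [exact: cg|exact: continuous_Im].
have [M1 H1] := bounded_on_box a b cR; have [M2 H2] := bounded_on_box a b cI.
exists (M1 + M2) => t tab; apply: le_trans (normc_le_absReIm _) _.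
by apply: lerD; [exact: H1|exact: H2].
Qed.

Lemma hsum_le (S : finType) (th : S -> R) delta t : 0 < delta ->
  normc (hsum th (delta +i* t)) <= #|S|%:R * delta^-1.
Proof.
move=> d0; apply: le_trans (normc_sum _ _) _.
rewrite -sum1_card natr_sum mulr_suml; apply: ler_sum => s _.
by rewrite mul1r; apply: normc_ker_le => //; exact: lam1.
Qed.

End Bounds.

Section Restriction.
Context {d : measure_display} {T : measurableType d} {R : realType}.
Variable mu : probability T R.
Local Notation C := R[i].
Local Notation normc := (@ComplexField.Normc.normc R).

(** An indicator factor replaces the domain, so that the exchange lemmas, stated on the whole space,
    apply. *)
Lemma Cintegral_indic (D : set T) (h : T -> C) :
  Cintegral mu D h = Cintegral mu setT (fun x => (\1_D x : R)%:C * h x).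
Proof.
rewrite /Cintegral !(Rintegral_mkcond _ D); congr (_ +i* _);
  apply: eq_Rintegral => x _; rewrite /patch indicE; case: (x \in D) => /=;
  by case: (h x) => u v /=; rewrite ?(mul1r, mul0r, subr0, addr0).
Qed.

Lemma cmeas_indic (D : set T) : measurable D -> cmeas (fun x => (\1_D x : R)%:C).
Proof.
by move=> mD; split => /=; [exact: measurable_indic|exact: measurable_cst].
Qed.

Lemma normc_indic (D : set T) x : normc ((\1_D x : R)%:C) <= 1.
Proof.
by rewrite indicE /=; case: (x \in D); rewrite ?expr1n !expr0n ?addr0 ?sqrtr1 ?sqrtr0.
Qed.

End Restriction.

(** * Averaging over the group *)

Section FixedFactors.
Context {R : realType}.
Local Notation C := R[i].
Local Notation normc := (@ComplexField.Normc.normc R).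
Variables (S : finType) (t : S -> R).

(** [kfac] with the constant of the class M taken out: points of M contribute nothing to [J_USp]. *)
Definition jker (c : 'I_3) (z : C) : C :=
  match val c with 0 => hsum t z | 1 => hsum t (- z) | _ => 1 end.

Lemma prod_kfac n (c : {ffun 'I_n -> 'I_3}) (z : 'rV[C]_n) :
  \prod_k kfac t (c k) (z 0 k) = #|S|%:R ^+ #|fibre c 2| * \prod_k jker (c k) (z 0 k).
Proof.
rewrite -prodr_const [X in _ = X * _]big_mkcond -big_split; apply: eq_bigr => k _ /=.
by rewrite inE /kfac /jker; case: (c k) => -[|[|[|]]] //= _; rewrite ?mul1r ?mulr1.
Qed.

Lemma jker_continuous (c : 'I_3) z :
  complex.Re z != 0 -> {for z, continuous (jker c)}.
Proof.
move=> z0; have [c2|c2] := boolP (c < 2)%N.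
  have -> : jker c = kfac t c by apply/funext; case: c c2 => -[|[|m]].
  exact: kfac_continuous.
have -> : jker c = (fun=> 1) by apply/funext; case: c c2 => -[|[|m]].
exact: cst_continuous.
Qed.

(** For the class L the point is reflected to abscissa [delta]; the [+ 1] accounts for the class
    M. *)
Lemma jker_le delta c y : 0 < delta ->
  normc (jker c (kabs delta c +i* y)) <= #|S|%:R * delta^-1 + 1.
Proof.
move=> delta0; have p0 : 0 <= #|S|%:R * delta^-1 by rewrite mulr_ge0 ?ler0n// invr_ge0 ltW.
rewrite /jker /kabs; case: c => -[|[|m]] /= _.
- by apply: le_trans (hsum_le _ _ delta0) _; rewrite lerDl.
- rewrite (_ : - _ = delta +i* (- y)); last first.
    by apply/eqP; rewrite eq_complex /= opprK !eqxx.
  by apply: le_trans (hsum_le _ _ delta0) _; rewrite lerDl.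
- by rewrite expr1n expr0n addr0 sqrtr1 lerDr.
Qed.

End FixedFactors.

Section Assembly.
Context {R : realType} {N n : nat}.
Local Notation C := R[i].
Local Notation normc := (@ComplexField.Normc.normc R).
Local Notation T := (borel_mx R (N + N)).
Variable mu : probability T R.
Variable theta : 'M[C]_(N + N) -> 'I_N -> R.
Hypothesis spectrum : forall X : 'M[C]_(N + N), USp R N X ->
  (forall j, 0 <= theta X j <= pi) /\
  char_poly X = \prod_(j < N) (('X - (cexp (0 +i* theta X j))%:P) *
                               ('X - (cexp (0 -i* theta X j))%:P)).
Variable delta : R.
Hypothesis delta0 : 0 < delta.
Variable phi : 'rV[C]_n -> C.
Hypothesis sphi : sep_entire phi.
Hypothesis pphi : periodic phi.

Implicit Type c : {ffun 'I_n -> 'I_3}.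

(* Outside USp(2N) the angles are irrelevant; setting them to 0 makes every
   bound and continuity statement below hold for all matrices. *)
Let th (X : T) : 'I_N * bool -> R :=
  signed (fun j => if `[< USp R N X >] then theta X j else 0).

Let th_pi X s : - pi <= th X s <= pi.
Proof.
apply: signed_pi => j; case: asboolP => [/spectrum[+ _]|_]; first exact.
by rewrite lexx pi_ge0.
Qed.

Let W c (X : T) (z : 'rV[C]_n) : C :=
  (\1_(USp R N : set T) X : R)%:C * (\prod_k jker (th X) (c k) (z 0 k) * phi z).

(** Replaces the angles, whose dependence on X is arbitrary, by [jfac], which is measurable in X.
    The indicator confines the identity to matrices whose spectrum [theta] describes. *)
Lemma prod_J_USp c (X : T) (z : 'rV[C]_n) : (forall k, complex.Re (z 0 k) != 0) ->
  (\1_(USp R N : set T) X : R)%:C * (\prod_k jker (th X) (c k) (z 0 k)) =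
  (\1_(USp R N : set T) X : R)%:C *
  \prod_(a <- [seq z 0 k | k in fibre c 0] ++ [seq - z 0 l | l in fibre c 1])
    jfac (X : 'M[C]_(N + N)) a.
Proof.
move=> z0; rewrite indicE; have [XU|] := boolP (X \in _); last by rewrite !mul0r.
have {}XU : USp R N X by exact: set_mem.
have [_ chiX] := spectrum XU; congr (_ * _).
have thE : th X = signed (theta X).
  apply/funext => s; congr (_ * _).
  by case: asboolP.
rewrite thE big_cat !big_map !big_enum /= 
  [X in _ = X * _]big_mkcond [X in _ = _ * X]big_mkcond -big_split /=.
apply: eq_bigr => k _; rewrite !inE /jker /=; have := z0 k.
case: (c k) => -[|[|m]] /= _ zk; rewrite ?mul1r ?mulr1 //.
  by rewrite (jfac_hsum chiX).
rewrite (jfac_hsum chiX) //; move: zk; case: (z 0 k) => x y /=.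
by rewrite oppr_eq0.
Qed.

Let line_Re c (t : 'rV[R]_n) k : complex.Re (line (fun k => kabs delta (c k)) t 0 k) != 0.
Proof. by rewrite mxE /=; exact: kabs_neq0. Qed.

Let cont_W c X : line_cont (fun k => kabs delta (c k)) (W c X).
Proof.
have [cphi _] := sphi.
have cj k t : {for (kabs delta (c k) +i* t : C), continuous (jker (th X) (c k))}.
  by apply: jker_continuous; exact: kabs_neq0.
have c1 := line_cont_integrand cj cphi.
move=> t; have c2 : {for t, continuous (fun _ : 'rV[R]_n => (\1_(USp R N : set T) X : R)%:C)}.
  exact: cst_continuous.
exact: (continuousM c2 (c1 t)).
Qed.

Let U c (X : T) (z : 'rV[C]_n) : C :=
  (\1_(USp R N : set T) X : R)%:C * \prod_k jker (th X) (c k) (z 0 k).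

Let B := (#|{: 'I_N * bool}|%:R * delta^-1 + 1) ^+ #|'I_n|.

Let U_le c X t : normc (U c X (line (fun k => kabs delta (c k)) t)) <= 1 * B.
Proof.
rewrite ComplexField.Normc.normcM.
apply: ler_pM; [exact: normc_ge0|exact: normc_ge0|exact: normc_indic|].
by apply: normc_prod_le => k; rewrite mxE; apply: jker_le.
Qed.

Let meas_U c (t : 'rV[R]_n) : cmeas (fun X => U c X (line (fun k => kabs delta (c k)) t)).
Proof.
rewrite (_ : (fun X => _) = (fun X : T => (\1_(USp R N : set T) X : R)%:C *
  \prod_(a <- [seq line (fun k => kabs delta (c k)) t 0 k | k in fibre c 0] ++
              [seq - line (fun k => kabs delta (c k)) t 0 l | l in fibre c 1])
    jfac (X : 'M[C]_(N + N)) a)).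
  apply: cmeasM; first by apply: cmeas_indic; exact: measurable_USp.
  by apply: cmeas_prod => a; exact: cmeas_jfac.
by apply/funext => X; rewrite /U prod_J_USp// => k; exact: line_Re.
Qed.

Let WE c X z : W c X z = U c X z * phi z.
Proof. by rewrite /W /U mulrA. Qed.

Let W_bounded c : exists M, forall X (t : 'rV[R]_n), (forall k, - pi <= t 0 k <= pi) ->
  normc (W c X (line (fun k => kabs delta (c k)) t)) <= M.
Proof.
have [cphi _] := sphi.
have cl : continuous (fun t => phi (line (fun k => kabs delta (c k)) t)).
  by move=> t; apply: (@continuous_comp _ _ _ (line _) phi); [exact: continuous_line|exact: cphi].
have [M HM] := normc_bounded_on_box (- pi) pi cl.
exists (1 * B * M) => X t tpi; rewrite WE ComplexField.Normc.normcM.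
by apply: ler_pM; [exact: normc_ge0|exact: normc_ge0|exact: U_le|exact: HM].
Qed.

Let meas_W c (t : 'rV[R]_n) : cmeas (fun X => W c X (line (fun k => kabs delta (c k)) t)).
Proof.
rewrite (_ : (fun X => _) = (fun X => U c X (line (fun k => kabs delta (c k)) t) *
  phi (line (fun k => kabs delta (c k)) t))); last by apply/funext => X; rewrite WE.
by apply: cmeasM; [exact: meas_U|exact: cmeas_cst].
Qed.

(** Measurability and boundedness accompany the exchange because averaging the finite sum over [c]
    term by term requires them. *)
Lemma viter_J_USp c :
  [/\ cmeas (fun X => viter (fun k => kabs delta (c k)) (W c X)),
      exists M, forall X, normc (viter (fun k => kabs delta (c k)) (W c X)) <= M &
      Cintegral mu setT (fun X => viter (fun k => kabs delta (c k)) (W c X)) =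
      viter (fun k => kabs delta (c k)) (fun z =>
        J_USp mu ([seq z 0 k | k in fibre c 0] ++ [seq - z 0 l | l in fibre c 1]) * phi z)].
Proof.
have [M HM] := W_bounded c.
have [mW ->] := viter_exchange mu (fun t _ => meas_W c t) (@cont_W c) HM.
split=> //.
  by exists ((4 * pi) ^+ n * M) => X; apply: viter_norm => //; exact: HM.
apply: eq_viter => t; set z := line _ t.
rewrite /J_USp [in RHS]Cintegral_indic mulrC.
rewrite -(eq_Cintegral mu (D := setT) (fun X _ => @prod_J_USp c X z (line_Re c t))).
rewrite -(CintegralZ mu (phi z) (meas_U c t) (U_le c ^~ t)).
by apply: eq_Cintegral => X _; rewrite WE mulrC.
Qed.

(** No measurability of [h] is assumed: [pw] equates its restriction to the group, up to a constant,
    with a finite sum of measurable contour integrals. The scalar [e] stands for 2^n. *)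
Lemma Cintegral_eigenangles (h : T -> C) (e : C) : e != 0 ->
  (forall X : T, USp R N X ->
     \sum_(s : {ffun 'I_n -> 'I_N * bool}) phi (\row_k (0 +i* signed (theta X) (s k))) =
     e * h X) ->
  e * Cintegral mu (USp R N) h =
  (2 * pi%:C * 'i) ^- n * \sum_c (2 * N)%:R ^+ #|fibre c 2| *
    viter (fun k => kabs delta (c k)) (fun z =>
        J_USp mu ([seq z 0 k | k in fibre c 0] ++ [seq - z 0 l | l in fibre c 1]) * phi z).
Proof.
move=> e0 he; have [cphi _] := sphi.
have D0 : (2 * pi%:C * 'i) ^+ n != 0 :> C.
  rewrite expf_neq0// !mulf_neq0 ?pnatr_eq0//.
    by rewrite fmorph_eq0 gt_eqF// pi_gt0.
  by rewrite eq_complex /= oner_eq0 andbF.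
pose V c X := (2 * N)%:R ^+ #|fibre c 2| * viter (fun k => kabs delta (c k)) (W c X).
have pw X : \sum_c V c X =
    (2 * pi%:C * 'i) ^+ n * e * ((\1_(USp R N : set T) X : R)%:C * h X).
  have card2 : #|{: 'I_N * bool}| = (2 * N)%N.
    by rewrite card_prod card_ord card_bool mulnC.
  rewrite [in RHS]indicE; have [XU|XU] := boolP (X \in _); last first.
    rewrite mul0r mulr0 big1// => c _; rewrite /V.
    (* Zero is written [0 * 0] so that [viterZ] pulls out a factor 0. *)
    have -> : viter (fun k => kabs delta (c k)) (W c X) =
        viter (fun k => kabs delta (c k)) (fun=> 0 * 0).
      by apply: eq_viter => t; rewrite /W indicE (negbTE XU) !mul0r.
    by rewrite viterZ ?mul0r ?mulr0// => t; exact: cst_continuous.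
  have thE : th X = signed (theta X).
    apply/funext => s; congr (_ * _); case: asboolP => // nX.
    by case: nX; exact: set_mem XU.
  rewrite mul1r -mulrA -he; last exact: set_mem XU.
  rewrite -thE -(pointwise delta0 (th_pi X) flipK (signed_flip _) sphi pphi).
  apply: eq_bigr => c _.
  rewrite /V -viterZ //; apply: eq_viter => t.
  by rewrite /W indicE XU mul1r prod_kfac card2 mulrA.
have mV c : cmeas (V c).
  by have [mVc _ _] := viter_J_USp c; apply: cmeasM => //; exact: cmeas_cst.
have /choice[b Vb] c : exists M, forall X, normc (V c X) <= M.
  have [_ [M HM] _] := viter_J_USp c.
  exists (normc ((2 * N)%:R ^+ #|fibre c 2|) * M) => X.
  by rewrite ComplexField.Normc.normcM ler_wpM2l// normc_ge0.
have mS : cmeas (fun X => \sum_c V c X) by exact: cmeas_sum.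
have Sb X : normc (\sum_c V c X) <= \sum_c b c.
  by apply: le_trans (normc_sum _ _) _; apply: ler_sum => c _; exact: Vb.
rewrite Cintegral_indic.
have -> : (fun X => (\1_(USp R N : set T) X : R)%:C * h X) =
    (fun X => ((2 * pi%:C * 'i) ^+ n * e)^-1 * \sum_c V c X).
  by apply/funext => X; rewrite pw mulKf// mulf_neq0.
rewrite (CintegralZ mu _ mS Sb).
have cancel (D s : C) : e * ((D * e)^-1 * s) = D^-1 * s.
  by rewrite invfM mulrCA -mulrA mulKf.
rewrite cancel; congr (_ * _).
rewrite (Cintegral_sum mu _ mV Vb); apply: eq_bigr => c _.
have [mVc [M HM] <-] := viter_J_USp c.
exact: (CintegralZ mu _ mVc HM).
Qed.

End Assembly.

(** * From f to the function z -> f (iz) *)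

Section Rotation.
Context {R : realType} {n : nat}.
Local Notation C := R[i].
Variable f : 'rV[C]_n -> C.

Lemma sep_entire_rotation : (forall z, differentiable f z) ->
  sep_entire (fun z => f ('i *: z)).
Proof.
move=> df; split=> [z|k v z].
  apply: (@continuous_comp _ _ _ (fun z : 'rV[C]_n => 'i *: z) f).
    exact: scaler_continuous.
  exact: differentiable_continuous.
have -> : (fun s => f ('i *: (s *: delta_mx 0 k + v))) =
    (fun s => f (s *: ('i *: delta_mx 0 k) + 'i *: v)).
  by apply/funext => s; rewrite scalerDr !scalerA (mulrC s).
exact: differentiable_holo_line.
Qed.

(** ['i] times the period 2 pi i is - 2 pi, which the real period of [f] compensates. *)
Lemma periodic_rotation :
  (forall z k, f (z + (2 * pi)%:C *: delta_mx 0 k) = f z) ->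
  periodic (fun z => f ('i *: z)).
Proof.
move=> pf z k; rewrite -[LHS](pf _ k); congr f.
rewrite scalerDr scalerA -addrA -scalerDl.
rewrite (_ : 'i * _ + _ = 0) ?scale0r ?addr0//.
by apply/eqP; rewrite eq_complex /=; apply/andP; split; apply/eqP; ring.
Qed.

Lemma rotation_signed N (t : 'I_N -> R) (s : {ffun 'I_n -> 'I_N * bool}) :
  (forall (z : 'rV[C]_n) (e : 'I_n -> bool), f (\row_k ((-1) ^+ e k * z 0 k)) = f z) ->
  f ('i *: \row_k (0 +i* signed t (s k))) = f (\row_k (t (s k).1)%:C).
Proof.
(* Since i * i = -1 reverses every sign, the boolean is negated. *)
move=> ef; rewrite -[RHS](ef _ (fun k => ~~ (s k).2)); congr f.
apply/rowP => k; rewrite !mxE /signed.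
by case: (s k) => j [] /=; rewrite ?(expr0, expr1); apply/eqP;
  rewrite eq_complex /=; apply/andP; split; apply/eqP; ring.
Qed.

End Rotation.

Local Close Scope classical_set_scope.

Theorem theorem3p2 (R : realType) (N n : nat)
  (mu : probability (borel_mx R (N + N)) R)
  (theta : 'M[R[i]]_(N + N) -> 'I_N -> R)
  (delta : R) (f : 'rV[R[i]]_n -> R[i]) :
  is_haar_USp mu ->
  (forall X : 'M[R[i]]_(N + N), USp R N X ->
     (forall j, 0 <= theta X j <= pi) /\
     char_poly X =
       \prod_(j < N) (('X - (cexp (0 +i* theta X j))%:P) *
                      ('X - (cexp (0 -i* theta X j))%:P))) ->
  0 < delta ->
  (forall z : 'rV[R[i]]_n, differentiable f z) ->
  (forall (z : 'rV[R[i]]_n) (k : 'I_n),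
     f (z + (2 * pi)%:C *: delta_mx 0 k) = f z) ->
  (forall (z : 'rV[R[i]]_n) (s : 'I_n -> bool),
     f (\row_k ((-1) ^+ s k * z 0 k)) = f z) ->
  2 ^+ n * Cintegral mu (USp R N) (fun X =>
      \sum_(j : {ffun 'I_n -> 'I_N}) f (\row_k (theta X (j k))%:C))
  = (2 * pi%:C * 'i%C) ^- n *
    \sum_(K : {set 'I_n}) \sum_(L : {set 'I_n})
      \sum_(M : {set 'I_n} |
          [&& [disjoint K & L], [disjoint K & M], [disjoint L & M] &
              K :|: L :|: M == [set: 'I_n]])
        (2 * N)%:R ^+ #|M| *
        viter (fun k => if k \in K then delta else - delta)
          (fun z => J_USp mu ([seq z 0 k | k in K] ++
                              [seq - z 0 l | l in L]) * f ('i%C *: z)).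
Proof.
move=> _ spectrum delta0 df pf ef.
rewrite sum_ordered_partitions.
have e0 : 2 ^+ n != 0 :> R[i] by rewrite expf_neq0// pnatr_eq0.
rewrite (@Cintegral_eigenangles _ _ _ mu theta spectrum delta delta0 (fun z => f ('i *: z))
  (sep_entire_rotation df) (periodic_rotation pf) _ _ e0); last first.
  move=> X _; rewrite (@sum_ffun_signed _ _ _ _ (fun j => f (\row_k (theta X (j k))%:C))).
    by rewrite -[LHS]mulr_natl natrX.
  move=> s; rewrite rotation_signed//; congr f.
  by apply/rowP => k; rewrite !mxE ffunE.
congr (_ * _); apply: eq_bigr => c _; congr (_ * viter _ _).
by apply/funext => k; rewrite /kabs inE.
Qed.
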